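(* Let $q$ be a prime power. One has the identity of power series in $t$ $$\prod_{f}(1-t^{\deg(f)})^{-1}=\sum_{l=0}^{\infty}q^lt^l=\frac{1}{1-qt},$$ where $f$ runs over all monic irreducible polynomials in $\mathbb{F}_q[x]$. Putting $t=q^{-j}$, $j\in\mathbb{N}$, one gets $$\zeta_q(j)^{-1}=1-\frac{1}{q^{j-1}}.$$ Hence, for integers $1\le k\le n$, if $E$ is the set of all $k\times n$ unimodular matrices over $\mathbb{F}_q[x]$, the natural density of $E$ in $M_{k\times n}(\mathbb{F}_q[x])$ is given explicitly by $$D(E)=\Bigl(1-\frac{1}{q^{n-k}}\Bigr)\Bigl(1-\frac{1}{q^{n-k+1}}\Bigr)\cdots\Bigl(1-\frac{1}{q^{n-1}}\Bigr),$$ and the numbers $\varphi_m$ of monic irreducible polynomials of degree $m$ in $\mathbb{F}_q[x]$ satisfy $$\prod_{m=1}^{\infty}\Bigl(1-\frac{1}{q^{jm}}\Bigr)^{\varphi_m}=1-\frac{1}{q^{j-1}},\quad\forall j\in\mathbb{N}.$$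
   Context: $\mathbb{N}$ is the set of positive integers. $\mathbb{F}_q$ is the finite field with $q$ elements, and $\mathbb{F}_q[x]$ is its polynomial ring. $M_{k\times n}(R)$ denotes the set of $k\times n$ matrices over a ring $R$. Irreducible polynomials are always taken to be monic (the constant polynomial $1$ is excluded), and $\varphi_m$ is the number of irreducible polynomials of degree $m$ in $\mathbb{F}_q[x]$. $q$-zeta function: $\zeta_q(j)=\prod_{f}\bigl(1-q^{-j\deg(f)}\bigr)^{-1}=\prod_{m=1}^{\infty}\bigl(1-q^{-jm}\bigr)^{-\varphi_m}$, where $f$ runs over all irreducible polynomials in $\mathbb{F}_q[x]$. For $j=1$ the value $\zeta_q(1)$ is not well defined, and the convention is $\zeta_q(1)^{-1}=0$. Unimodular: a matrix $A\in M_{k\times n}(\mathbb{F}_q[x])$ is unimodular if it can be extended, by adjoining $n-k$ further rows, to an $n\times n$ matrix invertible over $\mathbb{F}_q[x]$ (for $k=n$: if it is itself invertible over $\mathbb{F}_q[x]$). Enumeration of $\mathbb{F}_q[x]$: fix an identification (bijection) of $\{0,1,\dots,q-1\}$ with $\mathbb{F}_q$ in which the integer $0$ corresponds to $0\in\mathbb{F}_q$. For an integer $m\ge 0$ with base-$q$ expansion $m=\sum_{i\ge0}a_iq^i$, $a_i\in\{0,\dots,q-1\}$, $a_i=0$ for all large $i$, put $f_m(x)=\sum_{i\ge0}a_ix^i\in\mathbb{F}_q[x]$, where each $a_i$ is read as an element of $\mathbb{F}_q$ via the identification. This gives a bijection $m\mapsto f_m$ from the nonnegative integers to $\mathbb{F}_q[x]$.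 Natural density: let $\mathcal{M}=M_{k\times n}(\mathbb{F}_q[x])$, and let $\mathcal{M}_N$ be the set of matrices in $\mathcal{M}$ all of whose entries lie in $\{f_0,f_1,\dots,f_N\}$. For $S\subseteq\mathcal{M}$, the natural density is $D(S)=\lim_{N\to\infty}|S\cap\mathcal{M}_N|/|\mathcal{M}_N|$, if the limit exists. *)

(* Defs.v *)
From HB Require Import structures.
From mathcomp Require Import all_boot all_order all_algebra.
From mathcomp Require Import finmap.
From mathcomp Require Import all_classical all_reals all_analysis.
From mathcomp.analysis.showcase Require Import summability.

Set Implicit Arguments.
Unset Strict Implicit.
Unset Printing Implicit Defensive.

Import Order.TTheory GRing.Theory Num.Theory.
Import numFieldNormedType.Exports.

Local Open Scope classical_set_scope.
Local Open Scope ring_scope.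

(* [FPS a] is \sum_l a_l t^l.  The wrapper keeps the Cauchy product apart from
   the pointwise ring structure on functions. *)
Record fps (R : Type) := FPS { fps_coef : nat -> R }.

Definition fpsT {R : comUnitRingType} : fps R := FPS (fun n => (n == 1%N)%:R).

Section FpsRing.
Variable R : comUnitRingType.
Implicit Types (s u v : fps R) (n : nat).

HB.instance Definition _ := gen_eqMixin (fps R).
HB.instance Definition _ := gen_choiceMixin (fps R).

Lemma fpsP s u : (forall n, fps_coef s n = fps_coef u n) -> s = u.
Proof. by case: s u => [a] [b] /= ab; congr FPS; apply: funext. Qed.

Definition fps_zero : fps R := FPS (fun=> 0).
Definition fps_one : fps R := FPS (fun n => (n == 0%N)%:R).
Definition fps_opp s := FPS (fun n => - fps_coef s n).
Definition fps_add s u := FPS (fun n => fps_coef s n + fps_coef u n).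
Definition fps_mul s u :=
  FPS (fun n => \sum_(i < n.+1) fps_coef s i * fps_coef u (n - i)).

Fact fps_addA : associative fps_add.
Proof. by move=> s u v; apply: fpsP => n /=; rewrite addrA. Qed.
Fact fps_addC : commutative fps_add.
Proof. by move=> s u; apply: fpsP => n /=; rewrite addrC. Qed.
Fact fps_add0 : left_id fps_zero fps_add.
Proof. by move=> s; apply: fpsP => n /=; rewrite add0r. Qed.
Fact fps_addN : left_inverse fps_zero fps_opp fps_add.
Proof. by move=> s; apply: fpsP => n /=; rewrite addNr. Qed.

HB.instance Definition _ :=
  GRing.isZmodule.Build (fps R) fps_addA fps_addC fps_add0 fps_addN.

Definition fps_trunc N s : {poly R} := \poly_(i < N) fps_coef s i.

Lemma coef_fps_trunc_mul N s u n : (n < N)%N ->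
  (fps_trunc N s * fps_trunc N u)`_n = fps_coef (fps_mul s u) n.
Proof.
move=> nN; rewrite coefM /=; apply: eq_bigr => i _; rewrite !coef_poly.
by rewrite (leq_ltn_trans (leq_ord i) nN) (leq_ltn_trans (leq_subr _ _) nN).
Qed.

Fact fps_mulA : associative fps_mul.
Proof.
move=> s u v; apply: fpsP => n.
transitivity ((fps_trunc n.+1 s * (fps_trunc n.+1 u * fps_trunc n.+1 v))`_n).
  rewrite coefM /=; apply: eq_bigr => i _.
  rewrite coef_poly ltnS leq_ord coef_fps_trunc_mul //.
  by rewrite ltnS leq_subr.
rewrite mulrA coefM /=; apply: eq_bigr => i _.
rewrite coef_fps_trunc_mul // coef_poly.
by rewrite ltnS leq_subr.
Qed.
Fact fps_mulC : commutative fps_mul.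
Proof.
move=> s u; apply: fpsP => n.
by rewrite -!(@coef_fps_trunc_mul n.+1) // mulrC.
Qed.
Fact fps_mul1 : left_id fps_one fps_mul.
Proof.
move=> s; apply: fpsP => n /=; rewrite big_ord_recl /= mul1r subn0.
by rewrite big1 ?addr0 // => i _; rewrite mul0r.
Qed.
Fact fps_mulDl : left_distributive fps_mul fps_add.
Proof.
move=> s u v; apply: fpsP => n /=; rewrite -big_split /=.
by apply: eq_bigr => i _; rewrite mulrDl.
Qed.
Fact fps_one_neq0 : fps_one != 0.
Proof.
apply/eqP => /(congr1 (fun s => fps_coef s 0)) /= /eqP.
by rewrite oner_eq0.
Qed.

HB.instance Definition _ := GRing.Zmodule_isComNzRing.Build (fps R)
  fps_mulA fps_mulC fps_mul1 fps_mulDl fps_one_neq0.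

Definition fps_unit : {pred fps R} :=
  fun s => fps_coef s 0 \is a GRing.unit.

(* The first n coefficients of the inverse of a, solving a * b = 1 degree by
   degree. *)
Fixpoint fps_inv_seq (a : nat -> R) n : seq R :=
  if n is m.+1 then
    let b := fps_inv_seq a m in
    rcons b ((a 0%N)^-1 * ((m == 0%N)%:R - \sum_(i < m) b`_i * a (m - i)%N))
  else [::].

Definition fps_inv s : fps R :=
  if fps_unit s then FPS (fun n => (fps_inv_seq (fps_coef s) n.+1)`_n) else s.

Lemma size_fps_inv_seq a n : size (fps_inv_seq a n) = n.
Proof. by elim: n => //= n IHn; rewrite size_rcons IHn. Qed.

Lemma nth_fps_inv_seq a n i : (i < n)%N ->
  (fps_inv_seq a n)`_i = (fps_inv_seq a i.+1)`_i.
Proof.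
elim: n => // n IHn; rewrite ltnS leq_eqVlt => /predU1P[-> //|i_n].
by rewrite [in LHS]/= nth_rcons size_fps_inv_seq i_n IHn.
Qed.

Fact fps_mulVx : {in fps_unit, left_inverse 1 fps_inv *%R}.
Proof.
move=> s Us; apply: fpsP => n; rewrite /fps_inv.
have -> : fps_unit s = true by [].
rewrite [LHS]/= big_ord_recr /= subnn nth_rcons size_fps_inv_seq ltnn eqxx.
rewrite mulrAC mulVr // mul1r addrC -addrA.
rewrite -sumrN -big_split big1 ?addr0 // => i _ /=.
by rewrite (nth_fps_inv_seq _ (ltn_ord i)) /= addNr.
Qed.
Fact fps_unitPl s u : u * s = 1 -> fps_unit s.
Proof.
move=> /(congr1 (fun s => fps_coef s 0)) /=; rewrite big_ord1 subnn => us1.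
by apply/unitrPr; exists (fps_coef u 0); rewrite mulrC.
Qed.
Fact fps_inv_out : {in [predC fps_unit], fps_inv =1 id}.
Proof. by move=> s /negbTE Us; rewrite /fps_inv -topredE /= in Us *; rewrite Us. Qed.

HB.instance Definition _ := GRing.ComNzRing_hasMulInverse.Build (fps R)
  fps_mulVx fps_unitPl fps_inv_out.

End FpsRing.

(* Unordered infinite product for the t-adic topology: each coefficient is
   constant on all sufficiently large finite subproducts. *)
Definition fps_is_prod (R : comUnitRingType) (I : choiceType)
    (g : I -> fps R) (s : fps R) : Prop :=
  forall d : nat, \forall S \near totally,
    fps_coef (\prod_(i <- (S : {fset I})) g i) d = fps_coef s d.

Definition monic_irreducible (F : finFieldType) : pred {poly F} :=
  fun f => (f \is monic) && `[< irreducible_poly f >].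

Definition monic_irr (F : finFieldType) : choiceType :=
  {f : {poly F} | monic_irreducible f}.

Definition deg (F : finFieldType) (f : monic_irr F) : nat := (size (val f)).-1.

Definition phi (F : finFieldType) (m : nat) : nat :=
  #|` fset_set [set f : {poly F} | monic_irreducible f /\ size f = m.+1]|.

(* [fset_set] is only meaningful on finite sets. *)
Lemma finite_phi (F : finFieldType) (m : nat) :
  finite_set [set f : {poly F} | monic_irreducible f /\ size f = m.+1].
Proof.
apply: (sub_finite_set _ (finite_image (@rVpoly F m.+1)
  (@finite_finset _ [set: 'rV[F]_m.+1]))).
by move=> f /= [_ fm]; exists (poly_rV f); rewrite ?poly_rV_K ?fm.
Qed.

(* Used only for j >= 2, where the product converges. *)
Definition zetaq (R : realType) (F : finFieldType) (j : nat) : R :=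
  lim ((\prod_(f <- (S : {fset monic_irr F}))
         (1 - (#|F|%:R ^+ (j * deg f))^-1)^-1 : R) @[S --> totally]).

(* For j = 1 the product diverges and 1 / zeta_q(1) is 0 by convention. *)
Definition zetaq_inv (R : realType) (F : finFieldType) (j : nat) : R :=
  if j == 1%N then 0 else (zetaq R F j)^-1.

Definition unimodular (F : finFieldType) (k n : nat) (hkn : (k <= n)%N)
    (A : 'M[{poly F}]_(k, n)) : Prop :=
  exists B : 'M[{poly F}]_(n - k, n),
    castmx (subnKC hkn, erefl n) (col_mx A B) \in unitmx.

Section Enumeration.
Variables (F : finFieldType) (e : 'I_#|F| -> F).

Lemma card_field_gt0 : (0 < #|F|)%N.
Proof. by apply/card_gt0P; exists 0. Qed.

Definition digit (m i : nat) : 'I_#|F| :=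
  Ordinal (ltn_pmod (m %/ #|F| ^ i) card_field_gt0).

(* Only the digits of index i < m can be nonzero, since m < q^m. *)
Definition enum_poly (m : nat) : {poly F} := \poly_(i < m) e (digit m i).

Definition box (k n N : nat) : set 'M[{poly F}]_(k, n) :=
  [set A | forall i j, exists2 m, (m <= N)%N & A i j = enum_poly m].

Lemma finite_box k n N : finite_set (@box k n N).
Proof.
apply: (sub_finite_set _ (finite_image
  (fun B : 'M['I_N.+1]_(k, n) => \matrix_(i, j) enum_poly (B i j))
  (@finite_finset _ [set: 'M['I_N.+1]_(k, n)]))).
move=> A boxA; exists (\matrix_(i, j)
    odflt ord0 [pick m : 'I_N.+1 | A i j == enum_poly m]) => //.
apply/matrixP => i j; rewrite !mxE; case: pickP => [m /eqP-> //|noA].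
have [m mN Aij] := boxA i j.
by have := noA (Ordinal (mN : (m < N.+1)%N)); rewrite /= Aij eqxx.
Qed.

Definition has_natural_density (R : realType) (k n : nat)
    (S : set 'M[{poly F}]_(k, n)) (l : R) : Prop :=
  (#|` fset_set (S `&` @box k n N)|%:R / #|` fset_set (@box k n N)|%:R : R)
    @[N --> \oo] --> l.

End Enumeration.

(* Main.v *)
Require Import Defs.
From HB Require Import structures.
From mathcomp Require Import all_boot all_order all_algebra.
From mathcomp Require Import finmap.
From mathcomp Require Import all_classical all_reals all_analysis.
From mathcomp.analysis.showcase Require Import summability.
From mathcomp Require Import zify ring lra.
From mathcomp Require Import perm qfpoly.

(** The Euler product is a sieve.  Let [sieve S l] count the monic polynomials of
    degree [l] divisible by no member of a finite set [S] of irreducibles.  A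
    polynomial that survives [S] but not [f] is [f] times one that survives [S], so
    adding [f] to [S] multiplies the generating series by [1 - t ^ deg f]; starting
    from [\sum_l q ^ l t ^ l], the result is [1 + O(t ^ d.+1)] once [S] contains all
    irreducibles of degree at most [d].  At a real [0 <= t < 1 / q] the partial
    products are squeezed between [1 - q t] and [1 - q t + (q t) ^ d.+1]; at
    [t = 1 / q], where the product vanishes, they are compared with a smaller [t].

    A matrix is unimodular iff its rows stay independent modulo every irreducible.
    The integers [m <= N] are equidistributed modulo a fixed polynomial, so the
    condition at finitely many irreducibles has as density the product of the local
    proportions of full-rank matrices over [F[x] / f], which tends to the claimed
    value.  For [k < n] the irreducibles of degree above [d] contribute little.  When
    [q ^ deg f <= N], a dependence modulo [f] has a normalised coefficient vector,
    which determines one row modulo [f]; summing over vectors and over [f] bounds the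
    frequency by [O(q ^ -d)].  When [q ^ deg f > N], distinct entries are distinct
    modulo [f] and the top-left minor, if nonzero, has boundedly many such divisors,
    so one further entry is restricted to boundedly many values: frequency [O(1 / N)].
    For [k = n] the upper bound alone gives density [0]. *)

Set Implicit Arguments.
Unset Strict Implicit.
Unset Printing Implicit Defensive.

Import Order.TTheory GRing.Theory Num.Theory.
Import numFieldNormedType.Exports.

Local Open Scope classical_set_scope.
Local Open Scope ring_scope.

(** * Residue fields and the enumeration of polynomials *)

Section Residue.
Variable F : finFieldType.
Implicit Types (f p : {poly F}).

Lemma monic_irreducibleP f :
  monic_irreducible f -> irreducible_poly f * (f \is monic).
Proof. by case/andP=> fm /asboolP. Qed.

(** Packages [F[x] / f] as a field with a reduction map and a section, so that later arguments use
    only these three facts and never the concrete quotient type. *)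
Lemma residue_field f : monic_irreducible f ->
  exists (K : finFieldType) (pi : {rmorphism {poly F} -> K}) (s : K -> {poly F}),
   [/\ forall p, (pi p == 0) = (f %| p), cancel s pi
     & #|K| = (#|F| ^ (size f).-1)%N].
Proof.
move=> /monic_irreducibleP fi.
(* The quotient type reduces modulo [mk_monic f], which is a default modulus unless [f] is monic and
   nonconstant. *)
have hE : mk_monic f = f by apply: qfpoly.mk_monicE.
exists (qfpoly.qfpoly fi : finFieldType).
exists (in_qpoly f : {rmorphism {poly F} -> {poly %/ f}}).
exists (fun x : {poly %/ f} => val x); split.
- by move=> p; rewrite Pdiv.Idomain.dvdpE -val_eqE /= hE.
- move=> x; apply/val_inj.
  by rewrite /= Pdiv.CommonRing.rmodp_small // size_mk_monic.
- exact: qfpoly.card_qfpoly.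
Qed.
End Residue.

Section Enumeration.
Variables (F : finFieldType) (e : 'I_#|F| -> F).
Hypothesis e_bij : bijective e.
Hypothesis e0 : forall i : 'I_#|F|, val i = 0%N -> e i = 0.
Let q := #|F|.

Lemma card_field_gt1 : (1 < q)%N.
Proof. exact: card_finNzRing_gt1. Qed.

Lemma coef_enum_poly m i : (enum_poly e m)`_i = e (digit F m i).
Proof.
rewrite coef_poly; case: ltnP => // mi; rewrite e0 //=.
by rewrite divn_small ?mod0n // (leq_trans (ltn_expl m card_field_gt1)) // leq_exp2l ?card_field_gt1.
Qed.

Lemma digit_low E a b i : (b < q ^ E)%N -> (i < E)%N ->
  digit F (a * q ^ E + b) i = digit F b i.
Proof.
move=> bE iE; apply/val_inj => /=.
rewrite -/q (_ : a * q ^ E = (a * q ^ (E - i.+1) * q) * q ^ i)%N; last first.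
  by rewrite -mulnA -expnS -mulnA -expnD subnK.
by rewrite divnMDl ?expn_gt0 ?card_field_gt0 // modnMDl.
Qed.

Lemma digit_high E a b i : (b < q ^ E)%N ->
  digit F (a * q ^ E + b) (E + i) = digit F a i.
Proof.
move=> bE; apply/val_inj => /=.
by rewrite expnD -/q divnMA divnMDl ?expn_gt0 ?card_field_gt0 // (divn_small bE) addn0.
Qed.

(** The base-[q] digits of [a * q ^ E] and of [b] occupy disjoint positions, so no carry occurs.
    This cuts the integers into blocks of length [q ^ E] with a common high part. *)
Lemma enum_polyD E a b : (b < q ^ E)%N ->
  enum_poly e (a * q ^ E + b) = enum_poly e a * 'X^E + enum_poly e b.
Proof.
move=> bE; apply/polyP => i; rewrite coefD coefMXn !coef_enum_poly.
case: ltnP => iE; first by rewrite digit_low ?add0r.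
rewrite -{1}(subnKC iE) digit_high // [X in _ + X]e0 ?addr0 //=.
by rewrite divn_small ?mod0n // (leq_trans bE) // leq_exp2l ?card_field_gt1.
Qed.

Lemma size_enum_poly E b : (b < q ^ E)%N -> (size (enum_poly e b) <= E)%N.
Proof.
move=> bE; apply/leq_sizeP => i iE; rewrite coef_enum_poly e0 //=.
by rewrite divn_small ?mod0n // (leq_trans bE) // leq_exp2l ?card_field_gt1.
Qed.

Lemma enum_poly_small b : (b < q)%N -> forall c : 'I_#|F|, val c = b ->
  enum_poly e b = (e c)%:P.
Proof.
move=> bq c cb; rewrite (size1_polyC (size_enum_poly (E:=1) _)) //.
rewrite coef_enum_poly; congr (e _)%:P; apply/val_inj.
by rewrite /= expn0 divn1 modn_small.
Qed.

Lemma enum_poly_surj E (p : {poly F}) : (size p <= E)%N ->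
  exists2 b, (b < q ^ E)%N & p = enum_poly e b.
Proof.
have [e' eK e'K] := e_bij.
elim: E p => [|E IH] p.
  rewrite size_poly_leq0 => /eqP->; exists 0%N => //.
  by apply/esym/eqP; rewrite -size_poly_leq0 size_enum_poly.
elim/poly_ind: p => [_|p c _]; last first.
  rewrite size_MXaddC => pE.
  have /IH[b bE ->] : (size p <= E)%N by case: ifP pE => // /andP[/eqP-> _]; rewrite size_poly0.
  exists (b * q ^ 1 + e' c)%N.
    rewrite expn1 expnSr -/q; have := ltn_ord (e' c); rewrite -/q.
    set x := nat_of_ord _ => xq.
    by rewrite (@leq_trans (b.+1 * q)%N) ?leq_mul2r ?bE ?orbT // mulSn addnC ltn_add2r.
  rewrite enum_polyD ?expn1 ?ltn_ord // expr1.
  by rewrite (@enum_poly_small _ (ltn_ord (e' c)) (e' c)) // e'K.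
exists 0%N; rewrite ?expn_gt0 ?card_field_gt0 //.
by apply/esym/eqP; rewrite -size_poly_leq0 size_enum_poly.
Qed.

Lemma enum_poly_inj : injective (enum_poly e).
Proof.
suff H E : forall a b, (a < q ^ E)%N -> (b < q ^ E)%N -> enum_poly e a = enum_poly e b -> a = b.
  move=> a b; apply: (H (a + b).+1).
    by rewrite (leq_trans (ltn_expl a card_field_gt1)) // leq_exp2l ?card_field_gt1 // leqW // leq_addr.
  by rewrite (leq_trans (ltn_expl b card_field_gt1)) // leq_exp2l ?card_field_gt1 // leqW // leq_addl.
elim: E => [|E IH] a b; first by rewrite expn0 !ltnS !leqn0 => /eqP-> /eqP->.
move=> aE bE eq_ab.
have dig i : digit F a i = digit F b i.
  by apply: (bij_inj e_bij); rewrite -!coef_enum_poly eq_ab.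
have q0 := card_field_gt0 F.
have := dig 0%N => /(congr1 val) /=; rewrite expn0 !divn1 => mab.
rewrite (divn_eq a #|F|) (divn_eq b #|F|) mab; congr (_ * _ + _)%N.
apply: IH; rewrite ?ltn_divLR // -?expnSr //.
apply/polyP => i; rewrite !coef_enum_poly.
have := dig i.+1; rewrite /digit => /(congr1 val) /= mi.
by congr e; apply/val_inj; rewrite /= -!divnMA -expnS.
Qed.

Variable g : {poly F}.
Hypothesis g_monic : g \is monic.
Let E := (size g).-1.

Lemma size_gE : size g = E.+1.
Proof. by rewrite prednK // size_poly_gt0 monic_neq0. Qed.

(** Inside one block the high parts cancel, so the difference has degree below [E], the degree of
    [g]; divisibility by [g] then forces it to be zero. *)
Lemma class_inj_quotient i j : g %| enum_poly e i - enum_poly e j ->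
  (i %/ q ^ E = j %/ q ^ E)%N -> i = j.
Proof.
have qE : (0 < q ^ E)%N by rewrite expn_gt0 card_field_gt0.
rewrite {1}(divn_eq i (q ^ E)) {1}(divn_eq j (q ^ E)) !enum_polyD ?ltn_mod // => + ij.
rewrite ij opprD addrACA subrr add0r => gd.
suff mij : (i %% q ^ E = j %% q ^ E)%N.
  by rewrite (divn_eq i (q ^ E)) (divn_eq j (q ^ E)) ij mij.
apply: enum_poly_inj; apply/eqP; rewrite -subr_eq0; apply: contraTT gd => nz.
apply/negP => /(dvdp_leq nz); rewrite size_gE leqNgt ltnS.
rewrite (leq_trans (size_polyD _ _)) // size_polyN geq_max.
by rewrite !size_enum_poly ?ltn_mod.
Qed.

(** Each block meets a residue class at most once, and the integers up to [N] meet [N %/ q ^ E + 1]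
    blocks. *)
Lemma class_count_le N (r : {poly F}) :
  (#|[pred i : 'I_N.+1 | (g %| enum_poly e i - r)%R]| <= N %/ q ^ E + 1)%N.
Proof.
pose h (i : 'I_N.+1) : 'I_(N %/ q ^ E).+1 := inord (i %/ q ^ E).
rewrite -(@card_in_imset _ _ h).
  by rewrite (leq_trans (max_card _)) // card_ord addn1.
move=> i j; rewrite !inE => gi gj /(congr1 val).
have lt (x : 'I_N.+1) : (x %/ q ^ E < (N %/ q ^ E).+1)%N.
  by rewrite ltnS leq_div2r // -ltnS.
rewrite /h /= (inordK (lt i)) (inordK (lt j)) => ij.
apply/val_inj/class_inj_quotient => //.
rewrite (_ : _ - _ = (enum_poly e i - r) - (enum_poly e j - r)); last first.
  by rewrite opprB addrA subrK.
by rewrite dvdp_sub.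
Qed.

(** Each complete block meets the class: the offset in block [a] is the integer enumerating the
    remainder modulo [g] of [r] minus the high part. *)
Lemma class_count_ge N (r : {poly F}) :
  (N.+1 %/ q ^ E <= #|[pred i : 'I_N.+1 | (g %| enum_poly e i - r)%R]|)%N.
Proof.
have qE : (0 < q ^ E)%N by rewrite expn_gt0 card_field_gt0.
have /choice[b bP] : forall a, exists b, (b < q ^ E)%N /\
    enum_poly e b = (r - enum_poly e a * 'X^E) %% g.
  move=> a.
  have [|b bE ->] := @enum_poly_surj E ((r - enum_poly e a * 'X^E) %% g).
    by rewrite -ltnS -size_gE ltn_modp monic_neq0.
  by exists b.
have lt (a : 'I_(N.+1 %/ q ^ E)) : (a * q ^ E + b a < N.+1)%N.
  have [ba _] := bP a.
  have : (a.+1 * q ^ E <= N.+1)%N by rewrite -leq_divRL.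
  by apply: leq_trans; rewrite mulSn addnC ltn_add2r.
pose h (a : 'I_(N.+1 %/ q ^ E)) : 'I_N.+1 := Ordinal (lt a).
rewrite -{1}(card_ord (N.+1 %/ q ^ E)) -(card_imset predT (f := h)); last first.
  move=> x y /(congr1 val) /= /(congr1 (fun t => t %/ q ^ E)%N).
  have [bx _] := bP x; have [by_ _] := bP y.
  by rewrite !divnMDl // (divn_small bx) (divn_small by_) !addn0 => /val_inj.
apply: subset_leq_card; apply/fintype.subsetP => _ /imsetP[a _ ->].
have [ba bE] := bP a; rewrite inE /= enum_polyD // bE.
set x := enum_poly e a * 'X^E; set z := r - x.
have -> : x + z %% g - r = z %% g - z by rewrite opprB addrCA -addrA.
by rewrite {2}(divp_eq z g) opprD addrCA subrr addr0 dvdpNr dvdp_mull.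
Qed.

End Enumeration.

(** * Unimodularity and dependence modulo irreducibles *)

Section Unimodular.
Variable F : finFieldType.
Implicit Types (f p : {poly F}).

Definition dependent_mod (k n : nat) f (A : 'M[{poly F}]_(k, n)) : Prop :=
  exists w : 'rV_k, (exists i, ~~ (f %| w 0 i)) /\ forall j, f %| (w *m A) 0 j.

(** A relation modulo [f] reduces to a nonzero vector of the left kernel over [K]; such a vector
    lifts entrywise through the section [s]. *)
Lemma dependent_modP (K : fieldType) (pi : {rmorphism {poly F} -> K})
    (s : K -> {poly F}) f k n (A : 'M[{poly F}]_(k, n)) :
    (forall p, (pi p == 0) = (f %| p)) -> cancel s pi ->
  dependent_mod f A <-> ~~ row_free (map_mx pi A).
Proof.
move=> pi0 sK; rewrite -kermx_eq0; split=> [[w [[i wi] wA]]|/rowV0Pn[v /sub_kermxP vA v0]].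
  apply/rowV0Pn; exists (map_mx pi w).
    apply/sub_kermxP; rewrite -map_mxM; apply/rowP => j.
    by rewrite !mxE; apply/eqP; rewrite pi0; have := wA j; rewrite mxE.
  by apply: contra wi => /eqP/rowP/(_ i); rewrite !mxE -pi0 => ->.
exists (map_mx s v).
have sv : map_mx pi (map_mx s v) = v by apply/rowP => j; rewrite !mxE sK.
split=> [|j].
  have /rV0Pn[i vi] := v0.
  by exists i; rewrite -pi0 mxE sK.
have := vA; rewrite -[in X in X -> _]sv -map_mxM => /rowP/(_ j) vAj.
by rewrite -pi0; move: vAj; rewrite [LHS]mxE [RHS]mxE => ->.
Qed.

Lemma irreducible_factor p : size p != 1%N ->
  exists2 f, monic_irreducible f & f %| p.
Proof.
have [N] := ubnP (size p); elim: N p => // N IH p; rewrite ltnS => pN p1.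
have [->|p0] := eqVneq p 0.
  (* Everything divides zero, so any irreducible serves as witness; the irreducibility of ['X] is
     checked by hand. *)
  exists 'X; last exact: dvdp0.
  apply/andP; split; first exact: monicX.
  apply/asboolP; split; first by rewrite size_polyX.
  move=> d d1 dX; rewrite -dvdp_size_eqp // size_polyX.
  have := dvdp_leq (negbT (polyX_eq0 F)) dX; rewrite size_polyX leq_eqVlt ltnS.
  case/predU1P => [->//|]; rewrite leq_eqVlt (negbTE d1) /= ltnS leqn0 size_poly_eq0 => /eqP d0.
  by move: dX; rewrite d0 dvd0p polyX_eq0.
have [pI|pI] := pselect (irreducible_poly p).
  exists ((lead_coef p)^-1 *: p); last by rewrite dvdpZl ?invr_eq0 ?lead_coef_eq0.
  apply/andP; split; first by rewrite monicE lead_coefZ mulVf ?lead_coef_eq0.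
  have c0 : (lead_coef p)^-1 != 0 by rewrite invr_eq0 lead_coef_eq0.
  apply/asboolP; split; first by rewrite size_scale //; case: pI.
  move=> d d1; rewrite dvdpZr // => dp.
  by rewrite eqp_sym (eqp_trans (eqp_scale _ _)) // eqp_sym; case: pI => _; apply.
have [d [d1 dp nd]] : exists d : {poly F}, [/\ size d != 1%N, d %| p & ~~ (d %= p)].
  apply: contrapT => H; apply: pI; split.
    by rewrite ltn_neqAle eq_sym p1 size_poly_gt0.
  move=> d d1 dp; apply/negPn/negP => nd; apply: H.
  by exists d; split.
have dlt : (size d < size p)%N.
  by rewrite ltn_neqAle dvdp_leq // andbT; apply: contra nd => dpE; rewrite -dvdp_size_eqp.
have [f fi fd] := IH d (leq_trans dlt pN) d1.
by exists f => //; apply: dvdp_trans dp.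
Qed.

Lemma unit_factor p : (forall f, monic_irreducible f -> ~~ (f %| p)) -> p \is a GRing.unit.
Proof.
move=> H; have [p1|/irreducible_factor[f /H/negP//]] := eqVneq (size p) 1%N.
by rewrite poly_unitE p1 /= unitfE -[p`_0]/(p`_1.-1) -p1 -lead_coefE lead_coef_eq0 -size_poly_gt0 p1.
Qed.

(* Euclidean descent: among all first entries of [a *m U] choose a nonzero one of least degree. *)
Lemma row_gcd n (a : 'rV[{poly F}]_(1 + n)) :
  exists2 U, U \in unitmx & exists d, a *m U = row_mx d 0.
Proof.
have [->|a0] := eqVneq a 0.
  by exists 1%:M; [exact: unitmx1|exists 0; rewrite mul0mx row_mx0].
have swap (U : 'M[{poly F}]_(1 + n)) (j : 'I_(1 + n)) : U \in unitmx ->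
    exists2 V, V \in unitmx & (a *m V) 0 ord0 = (a *m U) 0 j.
  move=> Uu; exists (U *m tperm_mx ord0 j).
    by rewrite unitmx_mul Uu unitmx_perm.
  by rewrite mulmxA -xcolE mxE tpermL.
pose P N := `[< exists2 U, U \in unitmx & (a *m U) 0 ord0 != 0 /\ size ((a *m U) 0 ord0) = N >].
have exP : exists N, P N.
  have /rV0Pn[j aj] := a0.
  have [V Vu Va] := swap 1%:M j (unitmx1 _ _).
  exists (size (a 0 j)); apply/asboolP; exists V => //.
  by rewrite Va mulmx1.
case: (ex_minnP exP) => N /asboolP[U Uu [U0 UN]] minN.
set b := a *m U in U0 UN.
have bE : b = row_mx (lsubmx b) (rsubmx b) by rewrite hsubmxK.
pose d := lsubmx b; pose c := rsubmx b.
have dE : d 0 0 = b 0 ord0 by rewrite mxE; congr (b _ _); apply/val_inj.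
pose Q : 'M[{poly F}]_(1, n) := \row_j (c 0 j %/ d 0 0).
pose V : 'M[{poly F}]_(1 + n) := block_mx 1%:M (- Q) 0 1%:M.
have Vu : V \in unitmx by rewrite unitmxE det_ublock !det1 mulr1 unitr1.
have bV : b *m V = row_mx d (c - d *m Q).
  by rewrite bE mul_row_block !mulmx1 mulmx0 addr0 mulmxN addrC.
have rE j : (c - d *m Q) 0 j = c 0 j %% d 0 0.
  have dQ : (d *m Q) 0 j = d 0 0 * (c 0 j %/ d 0 0).
    by rewrite [LHS]mxE big_ord1 [Q _ _]mxE.
  rewrite [LHS]mxE [X in _ + X]mxE dQ.
  by rewrite {1}(divp_eq (c 0 j) (d 0 0)) mulrC addrAC subrr add0r.
exists (U *m V); first by rewrite unitmx_mul Uu.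
exists d; rewrite mulmxA -/b bV; congr row_mx; apply/rowP => j.
apply/eqP; rewrite [in X in _ == X]mxE; apply/negPn/negP => rj.
have UVu : U *m V \in unitmx by rewrite unitmx_mul Uu.
have [W Wu Wa] := swap (U *m V) (rshift 1 j) UVu.
have aj : (a *m W) 0 ord0 = c 0 j %% d 0 0.
  by rewrite Wa mulmxA -/b bV row_mxEr rE.
have /minN : P (size (c 0 j %% d 0 0)).
  by apply/asboolP; exists W => //; rewrite aj -rE.
by rewrite leqNgt -UN -dE ltn_modp dE U0.
Qed.

(** Column operations clear the first row by [row_gcd]; the induction then acts on the lower right
    block and leaves that row unchanged. *)
Lemma column_trig k n (A : 'M[{poly F}]_(k, n)) :
  exists2 U, U \in unitmx & is_trig_mx (A *m U).
Proof.
elim: k n A => [|k IH] [|n] A.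
- by exists 1%:M; [exact: unitmx1|apply/is_trig_mxP; case].
- by exists 1%:M; [exact: unitmx1|apply/is_trig_mxP; case].
- by exists 1%:M; [exact: unitmx1|apply/is_trig_mxP => ? []].
have [U Uu [d dE]] := row_gcd (usubmx (A : 'M[{poly F}]_(1 + k, 1 + n))).
pose A' : 'M[{poly F}]_(1 + k, 1 + n) := A *m U.
have AE : A' = block_mx d 0 (dlsubmx A') (drsubmx A').
  rewrite -{1}(submxK A'); congr (block_mx _ _ _ _).
    by rewrite /ulsubmx -mul_usub_mx dE row_mxKl.
  by rewrite /ursubmx -mul_usub_mx dE row_mxKr.
have [V Vu Vt] := IH _ (drsubmx A').
pose W : 'M[{poly F}]_(1 + n) := block_mx 1%:M 0 0 V.
have Wu : W \in unitmx by rewrite unitmxE det_ublock det1 mul1r -unitmxE.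
exists (U *m W); first by rewrite unitmx_mul Uu.
have AW : A' *m W = block_mx d 0 (dlsubmx A') (drsubmx A' *m V).
  by rewrite {1}AE mulmx_block !mulmx1 !mulmx0 !mul0mx !addr0 add0r.
have -> : A *m (U *m W) = A' *m W by rewrite mulmxA.
have Wt : is_trig_mx (block_mx d 0 (dlsubmx A') (drsubmx A' *m V)).
  by rewrite (@is_trig_block_mx _ 1 k 1 n) // eqxx mx11_is_trig.
by rewrite AW; exact: Wt.
Qed.

(** If [A] extends to an invertible matrix, multiplying a relation modulo [f] by the inverse shows
    that [f] divides every coefficient. Conversely, column operations [U] turn [A] into a square
    block [L] followed by zeros. An irreducible factor of the determinant of [L] would make the rows
    dependent, so [L] is invertible, and the block diagonal matrix of [L] and the identity,
    multiplied by the inverse of [U], extends [A]. *)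
Lemma unimodularP k n (hkn : (k <= n)%N) (A : 'M[{poly F}]_(k, n)) :
  unimodular hkn A <-> forall f, monic_irreducible f -> ~ dependent_mod f A.
Proof.
rewrite /unimodular.
(* Replacing [n - k] by any [m] with [k + m = n] lets case analysis on this equation remove the
   cast. *)
suff [H1 H2] : (forall m (h : (k + m = n)%N) (B : 'M[{poly F}]_(m, n)),
    castmx (h, erefl n) (col_mx A B) \in unitmx ->
      forall f, monic_irreducible f -> ~ dependent_mod f A) /\
  forall m (h : (k + m = n)%N),
    (forall f, monic_irreducible f -> ~ dependent_mod f A) ->
    exists B : 'M[{poly F}]_(m, n), castmx (h, erefl n) (col_mx A B) \in unitmx.
  by split=> [[B /H1]|/H2]; apply.
split=> m h; case: _ / h {hkn} A => A.
  move=> B; rewrite castmx_id => AB f fi [w [[i wi] wA]].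
  have wAB j : f %| (row_mx w 0 *m col_mx A B) 0 j.
    by rewrite mul_row_col mul0mx addr0.
  have : f %| (row_mx w 0 *m col_mx A B *m invmx (col_mx A B)) 0 (lshift m i).
    rewrite mxE; apply: (big_ind (fun x => f %| x)); first exact: dvdp0.
      by move=> x y; exact: dvdp_add.
    by move=> j _; exact: dvdp_mulr.
  by rewrite mulmxK // row_mxEl (negbTE wi).
move=> nodep.
have [U Uu Ut] := column_trig A.
pose L := lsubmx (A *m U).
have AU : A *m U = row_mx L 0.
  rewrite -{1}(hsubmxK (A *m U)); congr row_mx; apply/matrixP => i j.
  rewrite [LHS]mxE [RHS]mxE; move/is_trig_mxP: Ut; apply=> /=.
  by rewrite (leq_trans (ltn_ord i)) // leq_addr.
have Lu : L \in unitmx.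
  rewrite unitmxE; apply: unit_factor => f fi; apply/negP => fL.
  have [K [pi [s [pi0 sK _]]]] := residue_field fi.
  have [_ H] := dependent_modP A pi0 sK; apply: (nodep f fi); apply: H.
  have piU : map_mx pi U \in unitmx by rewrite unitmxE det_map_mx rmorph_unit // -unitmxE.
  rewrite -row_free_unit in piU *.
  rewrite /row_free -(mxrankMfree _ piU) -map_mxM AU map_row_mx map_mx0.
  have -> : \rank (row_mx (map_mx pi L) (0 : 'M[K]_(k, m))) = \rank (map_mx pi L).
    by rewrite -mxrank_tr tr_row_mx trmx0 -addsmxE addsmx0 mxrank_tr.
  apply/negP => LU; have : map_mx pi L \in unitmx by rewrite -row_free_unit.
  by rewrite unitmxE det_map_mx unitfE pi0 fL.
pose M := block_mx L 0 0 1%:M *m invmx U.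
exists (dsubmx M); rewrite castmx_id.
have -> : col_mx A (dsubmx M) = M.
  rewrite -{2}(vsubmxK M); congr col_mx.
  rewrite /M /block_mx mul_col_mx col_mxKu.
  by rewrite -AU mulmxK.
by rewrite unitmx_mul unitmx_inv Uu andbT unitmxE det_ublock det1 mulr1 -unitmxE.
Qed.

End Unimodular.

(** * The sieve and the Euler product *)

Section Sieve.
Variable F : finFieldType.
Let q := #|F|.
Implicit Types (f g : monic_irr F) (S : seq (monic_irr F)).

Lemma monic_irr_monic f : val f \is monic.
Proof. by case: (monic_irreducibleP (valP f)). Qed.

Lemma size_monic_irr f : size (val f) = (deg f).+1.
Proof. by rewrite prednK // size_poly_gt0 monic_neq0 // monic_irr_monic. Qed.

Lemma deg_gt0 f : (0 < deg f)%N.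
Proof. by case: (monic_irreducibleP (valP f)) => -[+ _] _; rewrite size_monic_irr. Qed.

Lemma monic_irr_Gauss f (p r : {poly F}) :
  (val f %| p * r) = (val f %| p) || (val f %| r).
Proof.
have [fI _] := monic_irreducibleP (valP f).
have [fp|fp] := boolP (val f %| p); first by rewrite dvdp_mulr.
by rewrite Gauss_dvdpr // irreducible_poly_coprime.
Qed.

Lemma monic_irr_dvd f g : (val f %| val g) = (f == g).
Proof.
apply/idP/eqP => [fg|->]; last exact: dvdpp.
have [[_ gI] gm] := monic_irreducibleP (valP g).
have [[f1 _] fm] := monic_irreducibleP (valP f).
apply/val_inj/eqP; rewrite -eqp_monic //; apply: gI => //.
by rewrite neq_ltn f1 orbT.
Qed.

Lemma monic_irr_factor (p : {poly F}) : size p != 1%N ->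
  exists f : monic_irr F, val f %| p.
Proof. by case/irreducible_factor => f fi fp; exists (exist _ f fi). Qed.

(** Indexes the monic polynomials of degree [l] by a finite type, so that they can be counted by
    cardinals. *)
Definition monic_of l (v : {poly_l F}) : {poly F} := 'X^l + v.

Lemma size_monic_of l (v : {poly_l F}) : size (monic_of v) = l.+1.
Proof. by rewrite /monic_of size_polyDl size_polyXn // ltnS size_npoly. Qed.

Lemma monic_of_monic l (v : {poly_l F}) : monic_of v \is monic.
Proof.
by rewrite monicE /monic_of lead_coefDl ?lead_coefXn // size_polyXn ltnS size_npoly.
Qed.

Lemma monic_ofP l (p : {poly F}) : p \is monic -> size p = l.+1 ->
  exists v : {poly_l F}, p = monic_of v.
Proof.
move=> pm ps; exists (npolyp l (p - 'X^l)).
have pX : (size (p - 'X^l)%R <= l)%N.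
  apply/leq_sizeP => i; rewrite leq_eqVlt coefB coefXn => /predU1P[<-|li].
    by move/monicP: pm; rewrite lead_coefE ps /= => ->; rewrite eqxx subrr.
  by rewrite gtn_eqF // nth_default ?subr0 // ps.
by rewrite /monic_of (npolypK pX) addrC subrK.
Qed.

Lemma monic_of_inj l : injective (@monic_of l).
Proof. by move=> u v /addrI /val_inj. Qed.

Definition sieve S l : nat :=
  #|[pred v : {poly_l F} | all (fun f => ~~ (val f %| monic_of v)) S]|.

Lemma sieve_nil l : sieve [::] l = (q ^ l)%N.
Proof. by rewrite /sieve -card_npoly. Qed.

Lemma sieve_le S l : (sieve S l <= q ^ l)%N.
Proof. by rewrite -card_npoly max_card. Qed.

Lemma sieve0 S : sieve S 0 = 1%N.
Proof.
rewrite /sieve -(expn0 #|F|) -card_npoly; apply: eq_card => v.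
rewrite !inE; apply/allP => f _; apply/negP => /dvdp_leq.
rewrite -size_poly_gt0 size_monic_of size_monic_irr => /(_ isT).
by rewrite ltnNge deg_gt0.
Qed.

(** The polynomials removed by [f] alone are the products of [f] with a monic [u] of degree
    [l - deg f]. No member of [S] divides [f], so such a product survives [S] exactly when [u]
    does. *)
Lemma sieve_cons f S l : f \notin S ->
  (sieve (f :: S) l + (if deg f <= l then sieve S (l - deg f) else 0) = sieve S l)%N.
Proof.
move=> fS.
rewrite [RHS]/sieve -(cardID [pred v : {poly_l F} | val f %| monic_of v]) [RHS]addnC.
congr (_ + _)%N.
have monM (u : {poly_(l - deg f) F}) : val f * monic_of u \is monic.
  by rewrite rpredM ?monic_irr_monic ?monic_of_monic.
case: leqP => fl; last first.
  apply/esym/eq_card0 => v; rewrite !inE; apply/negP => /andP[_] /dvdp_leq.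
  rewrite -size_poly_gt0 size_monic_of size_monic_irr => /(_ isT).
  by rewrite ltnNge fl.
have szM (u : {poly_(l - deg f) F}) : size (val f * monic_of u) = l.+1.
  by rewrite size_monicM ?monic_irr_monic ?monic_neq0 ?monic_of_monic //
    size_monic_irr size_monic_of addnS addSn /= subnKC.
have /choice[h hE] : forall u : {poly_(l - deg f) F},
    exists v : {poly_l F}, val f * monic_of u = monic_of v.
  by move=> u; apply: monic_ofP.
have h_inj : injective h.
  move=> u v /(congr1 (@monic_of l)); rewrite -!hE => /mulfI uv.
  by apply/monic_of_inj/uv; rewrite monic_neq0 // monic_irr_monic.
rewrite /sieve -(fintype.card_image h_inj); apply: eq_card => v.
rewrite !inE; apply/fintype.imageP/andP => /= [[u uS ->]|[vS /dvdpP[p pE]]].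
  rewrite -hE; split; last by rewrite dvdp_mulr.
  apply/allP => g gS; rewrite monic_irr_Gauss monic_irr_dvd negb_or.
  by rewrite (allP uS) // andbT; apply: contraNneq fS => <-.
have f0 : val f != 0 by rewrite monic_neq0 // monic_irr_monic.
have pm : p \is monic by rewrite -(monicMr _ (monic_irr_monic f)) -pE monic_of_monic.
have ps : size p = (l - deg f).+1.
  have := size_monic_of v; rewrite pE mulrC size_monicM ?monic_irr_monic ?monic_neq0 //.
  by rewrite size_monic_irr addSn /= -subSn // => <-; rewrite addKn.
have [u uE] := monic_ofP pm ps.
have vE : v = h u by apply: monic_of_inj; rewrite -hE pE uE mulrC.
exists u => //; apply/allP => g gS.
have := allP vS g gS; apply: contra; rewrite vE -hE; exact: dvdp_mull.
Qed.

(** A nonconstant polynomial of degree at most [d] has an irreducible factor of degree at most [d],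
    hence one in [S]. *)
Lemma sieve_eq0 S l d : (forall f, (deg f <= d)%N -> f \in S) ->
  (0 < l <= d)%N -> sieve S l = 0%N.
Proof.
move=> Sd /andP[l0 ld]; apply: eq_card0 => v; rewrite !inE.
have [f fv] : exists f : monic_irr F, val f %| monic_of v.
  by apply: monic_irr_factor; rewrite size_monic_of eqSS -lt0n.
apply/negP => /allP /(_ f); rewrite fv => /(_ _)/negP; apply=> //.
apply: Sd; rewrite (leq_trans _ ld) // -ltnS -size_monic_irr -(size_monic_of v).
by rewrite dvdp_leq // monic_neq0 // monic_of_monic.
Qed.

End Sieve.

(** * The Euler product as an identity of formal power series *)

Section EulerFps.
Variable F : finFieldType.
Let q := #|F|.

Lemma fpsTXn (R : comUnitRingType) m :
  (fpsT ^+ m : fps R) = FPS (fun n => (n == m)%:R).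
Proof.
elim: m => [|m IH]; first by rewrite expr0; apply: fpsP.
rewrite exprS IH; apply: fpsP => -[|n] /=.
  by rewrite big_ord1 mul0r.
rewrite 2!big_ord_recl /= mul0r add0r mul1r big1 ?addr0; last first.
  by move=> i _; rewrite mul0r.
by rewrite /bump /= subn1 eqSS.
Qed.

Lemma coef_fpsB (R : comUnitRingType) (s u : fps R) l :
  fps_coef (s - u) l = fps_coef s l - fps_coef u l.
Proof. by []. Qed.

Lemma coef_fpsMXn (R : comUnitRingType) (s : fps R) m l :
  fps_coef (s * fpsT ^+ m) l = if (m <= l)%N then fps_coef s (l - m) else 0.
Proof.
rewrite fpsTXn /=; case: leqP => ml; last first.
  by apply: big1 => i _; rewrite ltn_eqF ?mulr0 // (leq_ltn_trans (leq_subr _ _)).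
have lml : (l - m < l.+1)%N by rewrite ltnS leq_subr.
rewrite (bigD1 (Ordinal lml)) //= subKn // eqxx mulr1 big1 ?addr0 // => i il.
rewrite (_ : (_ == m) = false) ?mulr0 //; apply: contraNF il => /eqP lim.
by apply/eqP/val_inj; rewrite /= -lim subKn // -ltnS.
Qed.

Lemma fps_1subXn_unit (f : monic_irr F) : (1 - fpsT ^+ deg f : fps int) \is a GRing.unit.
Proof.
by rewrite fpsTXn /in_mem /= /fps_unit /= eq_sym gtn_eqF ?deg_gt0 // subr0.
Qed.

(** The recursion [sieve_cons] says that adding [f] multiplies the generating series by
    [1 - t ^ deg f]. *)
Lemma sieve_fps (S : seq (monic_irr F)) : uniq S ->
  FPS (fun l => (sieve S l)%:R : int) =
  FPS (fun l => (q ^ l)%:R : int) * \prod_(f <- S) (1 - fpsT ^+ deg f).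
Proof.
elim: S => [_|f S IH /= /andP[fS Su]].
  by rewrite big_nil mulr1; apply: fpsP => l /=; rewrite sieve_nil.
rewrite big_cons mulrCA -IH // mulrC mulrBr mulr1; apply: fpsP => l.
rewrite coef_fpsB coef_fpsMXn /=.
rewrite -(sieve_cons l fS) natrD; case: ifP => _; last by rewrite addr0 subr0.
by rewrite addrK.
Qed.

Lemma finite_deg_le d : finite_set [set f : monic_irr F | (deg f <= d)%N].
Proof.
have fin : finite_set [set p : {poly F} | (size p <= d.+1)%N].
  apply: (sub_finite_set _ (finite_image (fun p : {poly_d.+1 F} => p : {poly F})
    (@finite_finset _ [set: {poly_d.+1 F}]))).
  by move=> p /= pd; exists (npolyp d.+1 p) => //; rewrite npolypK.
rewrite (_ : mkset _ = (fun f : monic_irr F => val f) @^-1`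
    [set p : {poly F} | (size p <= d.+1)%N]).
  by apply: finite_preimage => // f g _ _; exact: val_inj.
by apply/seteqP; split=> f /=; rewrite size_monic_irr.
Qed.

Definition irr_le d : {fset monic_irr F} :=
  fset_set [set f : monic_irr F | (deg f <= d)%N].

Lemma irr_leP d (f : monic_irr F) : (f \in irr_le d) = (deg f <= d)%N.
Proof. by rewrite in_fset_set ?inE //=; last exact: finite_deg_le; apply/asboolP/idP. Qed.

(** Once [S] contains every irreducible of degree at most [d], the sieve series is 1 up to degree
    [d]. Since the geometric series is the partial Euler product times the sieve series, the two
    agree in coefficient [d]. *)
Lemma euler_fps : fps_is_prod (fun f : monic_irr F => (1 - fpsT ^+ deg f)^-1)
        (FPS (fun l => (q ^ l)%:R : int)).
Proof.
move=> d; exists (irr_le d) => // S /= dS.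
have inv1 : \prod_(f <- S) (1 - fpsT ^+ deg f : fps int)^-1 *
    \prod_(f <- S) (1 - fpsT ^+ deg f) = 1.
  by rewrite -big_split big1 // => f _; rewrite /= mulVr // fps_1subXn_unit.
have qE : FPS (fun l => (q ^ l)%:R : int) =
    \prod_(f <- S) (1 - fpsT ^+ deg f)^-1 * FPS (fun l => (sieve S l)%:R : int).
  by rewrite (sieve_fps (fset_uniq S)) mulrCA inv1 mulr1.
transitivity (fps_coef (FPS (fun l => (q ^ l)%:R : int)) d) => //; rewrite qE.
rewrite [RHS]/= big_ord_recr /= subnn sieve0 mulr1 [X in _ = X + _]big1 ?add0r // => i _.
rewrite (@sieve_eq0 _ _ _ d) ?mulr0 //; last by rewrite subn_gt0 ltn_ord leq_subr.
by move=> f fd; apply: (fsubsetP dS); rewrite irr_leP.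
Qed.

Lemma geometric_fps : FPS (fun l => (q ^ l)%:R : int) = (1 - q%:R * fpsT)^-1.
Proof.
have coefMn (s : fps int) n l : fps_coef (s *+ n) l = fps_coef s l *+ n.
  by elim: n => // n IH; rewrite mulrS [RHS]mulrS -IH.
apply/esym/mulr1_eq; rewrite mulrC mulrBr mulr1 mulrCA mulr_natl -(expr1 fpsT).
apply: fpsP => -[|l]; rewrite coef_fpsB coefMn coef_fpsMXn /= ?mul0rn ?subr0 //.
by rewrite subn1 /= expnSr natrM mulr_natr subrr.
Qed.
End EulerFps.

(* The Euler product at a real argument *)
#[local] Existing Instance totally_filter.

Section EulerReal.
Variables (R : realType) (F : finFieldType).
Let q := #|F|.
Implicit Types (S : seq (monic_irr F)) (t : R).

Definition euler_prod S t : R := \prod_(f <- S) (1 - t ^+ deg f).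

Definition sieve_sum S t : R^nat := fun L => \sum_(0 <= l < L) (sieve S l)%:R * t ^+ l.

Lemma sieve_sumS S t L : sieve_sum S t L.+1 = sieve_sum S t L + (sieve S L)%:R * t ^+ L.
Proof. by rewrite /sieve_sum big_nat_recr. Qed.

(** Truncated form of [sieve_cons]. When [deg f] exceeds [L], the natural subtraction gives 0 and
    the last sum is empty, as it should be. *)
Lemma sieve_sum_cons f S t L : f \notin S ->
  sieve_sum (f :: S) t L = sieve_sum S t L - t ^+ deg f * sieve_sum S t (L - deg f)%N.
Proof.
move=> fS; apply/eqP; rewrite eq_sym subr_eq eq_sym; apply/eqP.
elim: L => [|L IH]; first by rewrite sub0n /sieve_sum !big_geq // mulr0 addr0.
rewrite !(sieve_sumS _ _ L) -IH -(sieve_cons L fS) natrD mulrDl.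
case: leqP => fL.
  rewrite (subSn fL) sieve_sumS.
  have -> : t ^+ L = t ^+ deg f * t ^+ (L - deg f) by rewrite -exprD subnKC.
  by ring.
have /eqP-> : (L.+1 - deg f == 0)%N by rewrite subn_eq0.
have /eqP-> : (L - deg f == 0)%N by rewrite subn_eq0 ltnW.
by rewrite mul0r addr0 addrAC.
Qed.

Lemma sieve_sum_cvg S t : uniq S -> 0 <= t -> q%:R * t < 1 ->
  sieve_sum S t @ \oo --> euler_prod S t / (1 - q%:R * t).
Proof.
move=> + t0 qt; elim: S => [_|f S IH /= /andP[fS Su]].
  rewrite /euler_prod big_nil.
  rewrite (_ : sieve_sum _ _ = series (geometric 1 (q%:R * t))).
    by apply: cvg_geometric_series; rewrite ger0_norm // mulr_ge0.
  apply/funext => L; apply: eq_big_nat => l _ /=.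
  by rewrite sieve_nil natrX -exprMn mul1r.
rewrite /euler_prod big_cons -/(euler_prod S t) mulrBl mul1r mulrBl -mulrA.
rewrite (_ : sieve_sum _ _ = fun L => sieve_sum S t L - t ^+ deg f * sieve_sum S t (L - deg f)%N).
  apply: cvgB; first exact: IH.
  by apply: cvgZr; have := IH Su; rewrite -(cvg_centern (deg f)).
by apply/funext => L; apply: sieve_sum_cons.
Qed.

(** With [z = q t], the sieve series sums to the product divided by [1 - z]. Its constant term 1
    gives the lower bound. Its coefficients vanish in degrees 1 to [d] and are at most [q ^ l]
    beyond, which bounds it above by [1 + z ^ d.+1 / (1 - z)]. *)
Lemma euler_prod_bounds S t d : uniq S -> (forall f, (deg f <= d)%N -> f \in S) ->
  0 <= t -> q%:R * t < 1 ->
  1 - q%:R * t <= euler_prod S t <= 1 - q%:R * t + (q%:R * t) ^+ d.+1.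
Proof.
move=> Su Sd t0 qt; set z := q%:R * t in qt *.
have z0 : 0 <= z by rewrite mulr_ge0.
have z1 : 0 < 1 - z by rewrite subr_gt0.
have cvS := sieve_sum_cvg Su t0 qt; rewrite -/z in cvS.
have lo L : 1 <= sieve_sum S t L.+1.
  rewrite /sieve_sum big_nat_recl // sieve0 mul1r expr0 lerDl.
  by apply: sumr_ge0 => i _; rewrite mulr_ge0 // exprn_ge0.
have hi L : sieve_sum S t L.+1 * (1 - z) <= (1 - z) + z ^+ d.+1 - z ^+ maxn L.+1 d.+1.
  elim: L => [|L IH].
    rewrite /sieve_sum big_nat1 sieve0 mul1r expr0 mul1r.
    by rewrite (maxn_idPr _) // addrK.
  rewrite sieve_sumS mulrDl.
  have [Ld|dL] := ltnP L d.
    rewrite (sieve_eq0 Sd) // mul0r mul0r addr0 (le_trans IH) //.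
    by rewrite !(maxn_idPr _) // ltnS // ltnW.
  rewrite (maxn_idPl _) in IH; last by rewrite ltnS.
  rewrite (maxn_idPl _); last by rewrite ltnS leqW.
  have : (sieve S L.+1)%:R * t ^+ L.+1 * (1 - z) <= z ^+ L.+1 * (1 - z).
    rewrite ler_wpM2r ?(ltW z1) // /z exprMn ler_wpM2r ?exprn_ge0 //.
    by rewrite -natrX ler_nat sieve_le.
  rewrite [X in _ <= X]mulrBr mulr1 -exprSr => H.
  by apply: le_trans (lerD IH H) _; lra.
have near_gt0 (P : nat -> Prop) : (forall L, P L.+1) -> \forall L \near \oo, P L.
  by move=> PS; exists 1%N => // -[].
have : 1 <= euler_prod S t / (1 - z).
  by apply: (cvgr_to_ge cvS); apply: near_gt0.
rewrite ler_pdivlMr // mul1r => -> /=.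
rewrite -(ler_pM2r (_ : 0 < (1 - z)^-1)) ?invr_gt0 //.
apply: (cvgr_to_le cvS); apply: near_gt0 => L.
rewrite ler_pdivlMr // (le_trans (hi L)) // gerBl exprn_ge0 //.
Qed.

Lemma euler_prod_ge0 S t : 0 <= t <= 1 -> 0 <= euler_prod S t.
Proof.
by case/andP => t0 t1; apply: prodr_ge0 => f _; rewrite subr_ge0 exprn_ile1.
Qed.

Lemma euler_prod_anti S t u : 0 <= t -> t <= u -> u <= 1 -> euler_prod S u <= euler_prod S t.
Proof.
move=> t0 tu u1; have u0 := le_trans t0 tu.
rewrite /euler_prod !big_seq; apply: ler_prod => f _.
by rewrite subr_ge0 exprn_ile1 //= lerB // lerXn2r.
Qed.

Lemma euler_prod_near t (e : R) : 0 <= t -> q%:R * t <= 1 -> 0 < e ->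
  exists d, forall S, uniq S -> (forall f, (deg f <= d)%N -> f \in S) ->
    `|(1 - q%:R * t) - euler_prod S t| <= e.
Proof.
move=> t0 qt e0.
have q1 : 1 <= q%:R :> R by rewrite ler1n card_field_gt0.
have small (z c : R) : 0 <= z -> z < 1 -> 0 < c -> exists d, z ^+ d.+1 <= c.
  move=> z0 z1 c0; have /cvgrPdist_le/(_ _ c0)[d _ H] : GRing.exp z @ \oo --> (0 : R).
    by apply: cvg_expr; rewrite ger0_norm.
  by exists d; have := H d.+1 (leqnSn d); rewrite /= sub0r normrN ger0_norm // exprn_ge0.
have := qt; rewrite le_eqVlt => /orP[/eqP qt1|qt1].
  pose c := Num.min e 1 / 2.
  have c0 : 0 < c by rewrite divr_gt0 // lt_min e0 ltr01.
  have c1 : c < 1 by rewrite ltr_pdivrMr // mul1r gt_min ltr1n orbT.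
  have c2 : c + c <= e by rewrite -splitr ge_min lexx.
  pose u := t * (1 - c).
  have qu : q%:R * u = 1 - c by rewrite /u mulrA qt1 mul1r.
  have u0 : 0 <= u by rewrite mulr_ge0 // subr_ge0 ltW.
  have ut : u <= t by rewrite /u ler_piMr // gerBl ltW.
  have t1 : t <= 1 by rewrite -qt1 ler_peMl.
  have [d dc] := small (1 - c) c ltac:(lra) ltac:(lra) c0.
  exists d => S Su Sd.
  have := euler_prod_bounds Su Sd u0; rewrite qu => /(_ ltac:(lra))/andP[_ ub].
  have ae := euler_prod_anti S u0 ut t1.
  have P0 : 0 <= euler_prod S t by apply: euler_prod_ge0; rewrite t0.
  by rewrite qt1 subrr sub0r normrN ger0_norm //; lra.
have [d dc] := small _ _ (mulr_ge0 (ler0n R q) t0) qt1 e0.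
exists d => S Su Sd; have /andP[lb ub] := euler_prod_bounds Su Sd t0 qt1.
by rewrite distrC ger0_norm ?subr_ge0 //; lra.
Qed.

Lemma euler_prod_cvg t : 0 <= t -> q%:R * t <= 1 ->
  euler_prod (S : {fset monic_irr F}) t @[S --> totally] --> 1 - q%:R * t.
Proof.
move=> t0 qt; apply/cvgrPdist_le => e e0.
have [d H] := euler_prod_near t0 qt e0.
exists (irr_le F d) => // S /= dS; apply: H; first exact: fset_uniq.
by move=> f fd; apply: (fsubsetP dS); rewrite irr_leP.
Qed.

Lemma euler_prod_irr_le_cvg t : 0 <= t -> q%:R * t <= 1 ->
  euler_prod (irr_le F N) t @[N --> \oo] --> 1 - q%:R * t.
Proof.
move=> t0 qt; apply/cvgrPdist_le => e e0.
have [d H] := euler_prod_near t0 qt e0.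
exists d => // N /= dN; apply: H; first exact: fset_uniq.
by move=> f fd; rewrite irr_leP (leq_trans fd).
Qed.

Lemma prod_irr_le (g : nat -> R) N :
  \prod_(f <- irr_le F N) g (deg f) = \prod_(1 <= m < N.+1) g m ^+ phi F m.
Proof.
(* Each factor becomes a product over the single degree [m = deg f]; exchanging the two products
   then groups the factors by degree. *)
transitivity (\prod_(f <- irr_le F N) \prod_(m <- index_iota 1 N.+1 | m == deg f) g m).
  apply: eq_big_seq => f; rewrite irr_leP => fN.
  rewrite -big_filter (@eq_filter _ _ (pred1 (deg f))) // filter_pred1_uniq ?iota_uniq ?big_seq1 //.
  by rewrite mem_index_iota ltnS fN andbT deg_gt0.
rewrite (exchange_big_dep xpredT) //=; apply: eq_big_seq => m.
rewrite mem_index_iota ltnS => /andP[m0 mN].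
rewrite big_const_seq -Monoid.iteropE; congr (_ ^+ _).
rewrite -size_filter /phi -(size_map val); apply: perm_size; apply: uniq_perm.
- by rewrite (map_inj_uniq val_inj) filter_uniq // fset_uniq.
- exact: fset_uniq.
move=> p; rewrite in_fset_set; last exact: finite_phi.
apply/mapP/idP => [[f]|].
  rewrite mem_filter => /andP[/eqP-> _] ->; rewrite inE /=; split; first exact: (valP f).
  exact: size_monic_irr.
rewrite inE /= => -[pI ps]; have pd : deg (exist _ p pI : monic_irr F) = m by rewrite /deg /= ps.
by exists (exist _ p pI) => //; rewrite mem_filter pd eqxx irr_leP pd.
Qed.

End EulerReal.

(** * Local densities *)

Section RowFree.
Variable K : finFieldType.

Lemma row_free_col_mx n k (u : 'rV[K]_n) (A : 'M[K]_(k, n)) :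
  row_free (col_mx u A) = row_free A && ~~ (u <= A)%MS.
Proof.
rewrite /row_free -addsmxE.
have [uA|uA] := boolP (u <= A)%MS.
  rewrite andbF (addsmx_idPr uA).
  by rewrite ltn_eqF // ltnS rank_leq_row.
rewrite andbT; apply/eqP/eqP => [uAk|Ak].
  apply/eqP; rewrite eqn_leq rank_leq_row /= -(leq_add2l 1) -uAk.
  by rewrite (leq_trans (mxrank_adds_leqif u A)) // leq_add2r rank_leq_row.
apply/eqP; rewrite eqn_leq (leq_trans (mxrank_adds_leqif u A)) /=; last first.
  by rewrite Ak leq_add2r rank_leq_row.
rewrite add1n -[X in (X < _)%N]Ak; apply: rank_ltmx.
by rewrite /ltmx addsmxSr; apply: contra uA; rewrite addsmx_sub => /andP[].
Qed.

Lemma card_submx n k (A : 'M[K]_(k, n)) : row_free A ->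
  #|[pred u : 'rV[K]_n | (u <= A)%MS]| = (#|K| ^ k)%N.
Proof.
move=> /row_free_inj Ainj; rewrite -[RHS](_ : #|'rV[K]_k| = _); last by rewrite card_mx mul1n.
rewrite -(fintype.card_image (Ainj 1%N)).
apply: eq_card => u; rewrite !inE; apply/submxP/fintype.imageP => -[w]; by exists w.
Qed.

(** Rows are chosen one at a time: after [i] independent rows the next one must avoid their span,
    which has [#|K| ^ i] elements. *)
Lemma card_row_free n k :
  #|[pred A : 'M[K]_(k, n) | row_free A]| = (\prod_(i < k) (#|K| ^ n - #|K| ^ i))%N.
Proof.
elim: k => [|k IH].
  rewrite big_ord0 (@eq_card _ _ predT) ?card_mx ?mul0n //.
  by move=> A; rewrite !inE /row_free -leqn0 rank_leq_row.
rewrite big_ord_recr /= -IH -sum1_card -sum_nat_const.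
pose h (p : 'rV[K]_n * 'M[K]_(k, n)) : 'M[K]_(1 + k, n) := col_mx p.1 p.2.
rewrite (reindex h) /=; last first.
  exists (fun A : 'M[K]_(1 + k, n) => (usubmx A, dsubmx A)) => [[u A] _|A _].
    by rewrite /h /= col_mxKu col_mxKd.
  by rewrite /h /= vsubmxK.
under eq_bigl do rewrite inE /h row_free_col_mx.
transitivity (\sum_(A : 'M[K]_(k, n) | row_free A) \sum_(u : 'rV[K]_n | ~~ (u <= A)%MS) 1)%N.
  by rewrite pair_big_dep /= (reindex (fun p => (p.2, p.1))) //=; exists (fun p => (p.2, p.1)) => -[].
apply: eq_bigr => A Af; rewrite sum1_card.
rewrite -(card_submx Af) (_ : (#|K| ^ n)%N = #|'rV[K]_n|); last by rewrite card_mx mul1n.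
rewrite -(cardC [pred u : 'rV[K]_n | (u <= A)%MS]) addKn.
by apply: eq_card.
Qed.
End RowFree.

Section LocalDensity.
Variables (R : realType) (F : finFieldType).
Let q := #|F|.
Implicit Types (S : seq (monic_irr F)) (f : monic_irr F).

(** For [k <= n], the proportion of matrices of rank [k] among all [k] by [n] matrices over [F[x] /
    f]; see [card_row_free_local]. *)
Definition local_density k n f : R :=
  \prod_(i < k) (1 - (q%:R^-1) ^+ ((n - i) * deg f)).

Lemma card_row_free_local (K : finFieldType) k n f : #|K| = (q ^ deg f)%N ->
  (k <= n)%N ->
  #|[pred A : 'M[K]_(k, n) | row_free A]|%:R =
    #|'M[K]_(k, n)|%:R * local_density k n f :> R.
Proof.
move=> Kq kn; rewrite card_row_free card_mx /local_density.
rewrite natrX mulnC exprM natr_prod -[X in _ ^+ X](card_ord k) -prodr_const -big_split /=.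
apply: eq_bigr => i _.
have [iK in_] : (i < k)%N /\ (i <= n)%N by split=> //; rewrite ltnW // (leq_trans (ltn_ord i)).
have K0 : #|K|%:R != 0 :> R by rewrite pnatr_eq0 -lt0n card_field_gt0.
have -> : q%:R^-1 ^+ ((n - i) * deg f) = (#|K|%:R ^+ (n - i))^-1 :> R.
  by rewrite Kq natrX -exprM mulnC -exprVn.
rewrite natrB ?leq_exp2l ?card_field_gt1 // mulrBr mulr1 natrX natrX; congr (_ - _).
by rewrite -{1}(subnKC in_) exprD mulfK // expf_neq0.
Qed.

Lemma dependent_mod_congr (p : {poly F}) k n (A B : 'M[{poly F}]_(k, n)) :
  (forall i j, p %| A i j - B i j) -> dependent_mod p A -> dependent_mod p B.
Proof.
move=> AB [w [wi wA]]; exists w; split=> // j.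
rewrite (_ : (w *m B) 0 j = (w *m A) 0 j - (w *m (A - B)) 0 j); last first.
  have -> : (w *m (A - B)) 0 j = (w *m A) 0 j - (w *m B) 0 j.
    by rewrite mulmxBr [LHS]mxE [X in _ + X]mxE.
  by rewrite opprB addrCA subrr addr0.
rewrite dvdp_sub // mxE; apply: (big_ind (fun x => p %| x)); first exact: dvdp0.
  by move=> x y; exact: dvdp_add.
by move=> i _; rewrite dvdp_mull // !mxE.
Qed.

Definition full_rank_mod S k n (A : 'M[{poly F}]_(k, n)) : bool :=
  `[< forall f, f \in S -> ~ dependent_mod (val f) A >].

Lemma full_rank_mod_congr S (g : {poly F}) k n (A B : 'M[{poly F}]_(k, n)) :
    (forall f, f \in S -> val f %| g) ->
    (forall i j, g %| A i j - B i j) ->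
  full_rank_mod S A = full_rank_mod S B.
Proof.
move=> Sg AB; apply/asboolP/asboolP => H f fS df; apply: (H f fS).
  apply: dependent_mod_congr df => i j.
  by rewrite -dvdpNr opprB (dvdp_trans (Sg f fS)).
by apply: dependent_mod_congr df => i j; rewrite (dvdp_trans (Sg f fS)).
Qed.

Definition residue_system (g : {poly F}) (X : finType) (rep : X -> {poly F}) : Prop :=
  (forall x y, g %| rep x - rep y -> x = y) /\ (forall p, exists x, g %| p - rep x).

Lemma dvdp_prod_mem S f : f \in S -> val f %| \prod_(h <- S) val h.
Proof. by move=> fS; rewrite (big_rem f) //= dvdp_mulr. Qed.

(** The Chinese remainder theorem by induction on [S]: with [g] the product over [S], residues
    modulo [f g] are written [x + g y], where [x] represents a class modulo [g] and [y] one modulo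
    [f]. The conditions at [S] involve [x] only. *)
Lemma residue_count S k n : uniq S -> (k <= n)%N ->
  exists (X : finType) (rep : X -> {poly F}),
   [/\ residue_system (\prod_(f <- S) val f) rep,
       #|X| = (q ^ (\sum_(f <- S) deg f))%N
     & #|[pred B : 'M[X]_(k, n) | full_rank_mod S (map_mx rep B)]|%:R =
       #|'M[X]_(k, n)|%:R * \prod_(f <- S) local_density k n f :> R].
Proof.
move=> + kn; elim: S => [_|f S IH /= /andP[fS Su]].
  exists unit, (fun=> 0); split; rewrite ?big_nil ?expn0 ?card_unit //.
    by split=> [[] []|p] //; exists tt; rewrite dvd1p.
  rewrite mulr1; congr _%:R; apply: eq_card => B; rewrite !inE.
  exact/asboolP.
have [X [rep [[rinj rsurj] cX cB]]] := IH Su.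
set g := \prod_(f <- S) val f in rinj rsurj.
have [K [pi [s [pi0 sK cK]]]] := residue_field (valP f).
have sP p : val f %| p - s (pi p) by rewrite -pi0 rmorphB sK subrr.
have g0 : g != 0.
  by rewrite /g prodf_seq_neq0; apply/allP => h _ /=; rewrite monic_neq0 // monic_irr_monic.
have pig : pi g != 0.
  rewrite /g rmorph_prod prodf_seq_neq0; apply/allP => h hS /=.
  by rewrite pi0 monic_irr_dvd; apply: contraNneq fS => ->.
exists (X * K)%type, (fun xy => rep xy.1 + g * s xy.2); split.
- rewrite big_cons -/g; split=> [[x y] [x' y'] /=|p].
    rewrite opprD addrACA -mulrBr => H.
    have xx' : x = x'.
      apply: rinj; rewrite -(dvdp_addl _ (dvdp_mulr (s y - s y') (dvdpp g))).
      by apply: dvdp_trans H; apply: dvdp_mull.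
    move: H; rewrite xx' subrr add0r mulrC dvdp_mul2l // -pi0 rmorphB !sK subr_eq0.
    by move/eqP->.
  have [x /dvdpP[c cE]] := rsurj p; exists (x, pi c) => /=.
  by rewrite opprD addrA cE (mulrC c) -mulrBr (mulrC (val f)) dvdp_mul2l.
- by rewrite card_prod cX cK big_cons expnD mulnC.
pose h (B : 'M[X]_(k, n) * 'M[K]_(k, n)) : 'M[(X * K)%type]_(k, n) :=
  \matrix_(i, j) (B.1 i j, B.2 i j).
pose h' (C : 'M[(X * K)%type]_(k, n)) := (map_mx fst C, map_mx snd C).
have hK : cancel h h' by move=> [B C]; congr pair; apply/matrixP => i j; rewrite !mxE.
have h'K : cancel h' h.
  by move=> C; apply/matrixP => i j; rewrite !mxE; case: (C i j).
have cXK : #|'M[(X * K)%type]_(k, n)| = (#|'M[X]_(k, n)| * #|'M[K]_(k, n)|)%N.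
  by rewrite !card_mx card_prod expnMn.
rewrite cXK big_cons natrM [local_density _ _ _ * _]mulrC mulrACA.
rewrite -(card_row_free_local cK kn) -cB.
rewrite -natrM; congr _%:R.
rewrite -sum1_card -[in RHS]sum1_card big_distrl /= (reindex h) /=; last by exists h'.
transitivity (\sum_(B : 'M[X]_(k, n) | full_rank_mod S (map_mx rep B))
   \sum_(C : 'M[K]_(k, n) | row_free (map_mx pi (map_mx rep B) + pi g *: C)) 1)%N.
  rewrite pair_big_dep /=; apply: eq_bigl => -[B C]; rewrite inE.
  have modg : full_rank_mod S (map_mx (fun xy : X * K => rep xy.1 + g * s xy.2) (h (B, C))) =
      full_rank_mod S (map_mx rep B).
    apply: (@full_rank_mod_congr _ g); first exact: dvdp_prod_mem.
    by move=> i j; rewrite !mxE addrAC subrr add0r dvdp_mulr.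
  have modf : ~ dependent_mod (val f) (map_mx (fun xy : X * K => rep xy.1 + g * s xy.2) (h (B, C))) <->
      row_free (map_mx pi (map_mx rep B) + pi g *: C).
    rewrite -[X in row_free X](_ : map_mx pi (map_mx (fun xy => rep xy.1 + g * s xy.2) (h (B, C))) = _).
      by rewrite (dependent_modP _ pi0 sK); split=> [/negP/negPn|/negPn/negP].
    by apply/matrixP => i j; rewrite !mxE rmorphD rmorphM sK.
  rewrite /= -modg; apply/asboolP/andP => [H|[/asboolP H1 H2] h0].
    split; first by apply/asboolP => h0 h0S; apply: H; rewrite inE h0S orbT.
    by apply/modf/H; rewrite mem_head.
  by rewrite inE => /predU1P[->|/H1//]; apply/modf.
(* For fixed [B] the reduction modulo [f] is an affine bijection in [C], because [g] is invertible
   modulo [f]. The inner count is thus the same for every [B], which makes the condition at [f]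
   independent of those at [S]. *)
apply: eq_bigr => B _; rewrite mul1n.
rewrite -[RHS]sum1_card [RHS](reindex (fun C => map_mx pi (map_mx rep B) + pi g *: C)) //=.
exists (fun D => (pi g)^-1 *: (D - map_mx pi (map_mx rep B))) => D _.
  by rewrite addrAC subrr add0r scalerA mulVf // scale1r.
by rewrite scalerA mulfV // scale1r addrC subrK.
Qed.

End LocalDensity.

(** * Equidistribution *)

Lemma card_mx_pred (T : finType) k n (P : 'I_k -> 'I_n -> pred T) :
  #|[pred A : 'M[T]_(k, n) | [forall i, forall j, P i j (A i j)]]| =
  (\prod_i \prod_j #|P i j|)%N.
Proof.
pose h (f : {ffun 'I_k * 'I_n -> T}) : 'M[T]_(k, n) := \matrix_(i, j) f (i, j).
have h_bij : bijective h.
  exists (fun A : 'M[T]_(k, n) => [ffun p : 'I_k * 'I_n => A p.1 p.2]) => [f|A].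
    by apply/ffunP => -[i j]; rewrite ffunE mxE.
  by apply/matrixP => i j; rewrite mxE ffunE.
rewrite pair_big /= -(on_card_preimset (f := h)); last by apply: onW_bij.
have := card_family (fun p : 'I_k * 'I_n => [pred x | P p.1 p.2 x]).
rewrite foldrE big_map big_enum /= => <-; apply: eq_card => f.
rewrite !inE; apply/forallP/familyP => /= [H [i j]|H i].
  by have /forallP/(_ j) := H i; rewrite mxE.
by apply/forallP => j; rewrite mxE; exact: (H (i, j)).
Qed.

Section MainTerm.
Variables (R : realType) (F : finFieldType) (e : 'I_#|F| -> F).
Hypothesis e_bij : bijective e.
Hypothesis e0 : forall i : 'I_#|F|, val i = 0%N -> e i = 0.
Let q := #|F|.
Variables k n : nat.

Definition box_mx N (A : 'M['I_N.+1]_(k, n)) : 'M[{poly F}]_(k, n) :=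
  map_mx (fun i : 'I_N.+1 => enum_poly e i) A.

Definition box_freq N (P : pred 'M[{poly F}]_(k, n)) : R :=
  #|[pred A : 'M['I_N.+1]_(k, n) | P (box_mx A)]|%:R / #|'M['I_N.+1]_(k, n)|%:R.

(** The bounds on the size of a residue class put its frequency within [1 / N.+1] of the limit. *)
Lemma class_freq_cvg (g r : {poly F}) : g \is monic ->
  #|[pred i : 'I_N.+1 | (g %| enum_poly e i - r)%R]|%:R / N.+1%:R @[N --> \oo]
    --> ((q ^ (size g).-1)%:R^-1 : R).
Proof.
move=> gm; set Q := (q ^ _)%N.
have Q0 : (0 < Q)%N by rewrite expn_gt0 card_field_gt0.
apply/cvgrPdist_le => eps eps0.
have /cvgrPdist_le/(_ _ eps0)[N0 _ H] := @cvg_harmonic R.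
exists N0 => // N /= /H; rewrite /harmonic /= sub0r normrN => /(le_trans _); apply.
rewrite [X in _ <= X]ger0_norm ?invr_ge0 //.
have N10 : 0 < N.+1%:R :> R by rewrite ltr0n.
have QR : 0 < Q%:R :> R by rewrite ltr0n.
set c := #|_|.
have [lo hi] : (N.+1 %/ Q <= c)%N /\ (c <= N %/ Q + 1)%N.
  by split; [exact: class_count_ge | exact: class_count_le].
have lo' : N.+1%:R < (c.+1%:R * Q%:R) :> R.
  rewrite -natrM ltr_nat mulSn addnC [X in (X < _)%N](divn_eq N.+1 Q) -addnS.
  by rewrite leq_add ?ltn_mod // leq_mul2r lo orbT.
have hi' : c%:R * Q%:R <= N.+1%:R + Q%:R :> R.
  rewrite -natrM -natrD ler_nat (leq_trans (leq_mul hi (leqnn Q))) // mulnDl mul1n leq_add2r.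
  by rewrite (leq_trans (leq_trunc_div _ _)).
have -> : Q%:R^-1 - c%:R / N.+1%:R = (N.+1%:R - c%:R * Q%:R) / Q%:R / N.+1%:R :> R.
  by field; rewrite !gt_eqF.
rewrite normrM [X in _ * X]gtr0_norm ?invr_gt0 // -[X in _ <= X]mul1r ler_pM2r ?invr_gt0 //.
rewrite normrM [X in _ * X]gtr0_norm ?invr_gt0 // ler_pdivrMr // mul1r ler_norml.
rewrite -[c.+1]addn1 natrD mulrDl mul1r in lo'.
by apply/andP; split; lra.
Qed.

Lemma monic_prod_irr (S : seq (monic_irr F)) : \prod_(f <- S) val f \is monic.
Proof. by apply: monic_prod => f _; exact: monic_irr_monic. Qed.

Lemma size_prod_irr (S : seq (monic_irr F)) :
  (size (\prod_(f <- S) val f)).-1 = (\sum_(f <- S) deg f)%N.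
Proof.
elim: S => [|f S IH]; first by rewrite !big_nil size_poly1.
rewrite !big_cons size_monicM ?monic_irr_monic ?monic_neq0 ?monic_prod_irr //.
have : (0 < size (\prod_(f <- S) val f)%R)%N.
  by rewrite size_poly_gt0 monic_neq0 ?monic_prod_irr.
by rewrite size_monic_irr -IH; case: (size _) => // m _; rewrite addSn addnS.
Qed.

(** The condition depends only on the residues of the entries modulo the product [g] of [S]. The
    frequency is therefore a finite sum, over admissible residue matrices, of products of entry
    frequencies, each tending to [1 / #|X|]; [residue_count] evaluates the limit. *)
Lemma box_freq_full_rank_cvg (S : seq (monic_irr F)) : uniq S -> (k <= n)%N ->
  box_freq N (@full_rank_mod F S k n) @[N --> \oo]
    --> \prod_(f <- S) local_density R k n f.
Proof.
move=> Su kn; have [X [rep [[rinj rsurj] cX cB]]] := residue_count R Su kn.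
set g := \prod_(f <- S) val f in rinj rsurj.
have gm : g \is monic by apply: monic_prod_irr.
have [cl clP] := choice rsurj.
pose c N (x : X) : R := #|[pred i : 'I_N.+1 | (g %| enum_poly e i - rep x)%R]|%:R / N.+1%:R.
have cE N : box_freq N (@full_rank_mod F S k n) =
    \sum_(B : 'M[X]_(k, n) | full_rank_mod S (map_mx rep B)) \prod_(p : 'I_k * 'I_n) c N (B p.1 p.2).
  rewrite /box_freq -sum1_card (partition_big (fun A : 'M['I_N.+1]_(k, n) => map_mx cl (box_mx A))
    (fun B => full_rank_mod S (map_mx rep B))) /=; last first.
    move=> A HA; have <- : full_rank_mod S (box_mx A) = full_rank_mod S (map_mx rep (map_mx cl (box_mx A))).
      apply: (full_rank_mod_congr (g := g)); first exact: dvdp_prod_mem.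
      by move=> i j; rewrite [map_mx rep _ _ _]mxE [map_mx cl _ _ _]mxE; exact: clP.
    exact: HA.
  rewrite natr_sum mulr_suml; apply: eq_bigr => B HB.
  rewrite /c big_split /= prodr_const cardT -cardE card_prod !card_ord.
  rewrite card_mx card_ord natrX exprVn; congr (_ / _).
  rewrite -natr_prod sum1_card -(pair_big predT predT
     (fun i j => #|[pred t : 'I_N.+1 | (g %| enum_poly e t - rep (B i j))%R]|)) /=.
  rewrite -card_mx_pred; congr _%:R; apply: eq_card => A.
  change (full_rank_mod S (box_mx A) && (map_mx cl (box_mx A) == B) =
    [forall i, forall j, (g %| enum_poly e (A i j) - rep (B i j))%R]).
  have clE i j : (cl (enum_poly e (A i j)) == B i j) = (g %| enum_poly e (A i j) - rep (B i j)).
    apply/eqP/idP => [<-|H]; first exact: clP.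
    apply: rinj; rewrite -dvdpNr opprB.
    by rewrite -(subrKA (enum_poly e (A i j))) dvdp_add // -dvdpNr opprB.
  apply/andP/forallP => [[_ /eqP AB] i|H].
    by apply/forallP => j; rewrite /= -clE -AB !mxE.
  have AB : map_mx cl (box_mx A) = B.
    apply/matrixP => i j; rewrite !mxE; apply/eqP; rewrite clE.
    by have /forallP := H i; apply.
  split; last exact/eqP.
  have -> : full_rank_mod S (box_mx A) = full_rank_mod S (map_mx rep B) => //.
  apply: (full_rank_mod_congr (g := g)); first exact: dvdp_prod_mem.
  by move=> i j; rewrite mxE [map_mx rep B i j]mxE -clE -AB !mxE.
under eq_fun do rewrite cE.
have -> : \prod_(f <- S) local_density R k n f =
    \sum_(B : 'M[X]_(k, n) | full_rank_mod S (map_mx rep B))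
      \prod_(p : 'I_k * 'I_n) (#|X|%:R^-1 : R).
  transitivity (#|[pred B : 'M[X]_(k, n) | full_rank_mod S (map_mx rep B)]|%:R *
      (#|X|%:R^-1 : R) ^+ (k * n)); last first.
    by rewrite sumr_const prodr_const cardT -cardE card_prod !card_ord -[RHS]mulr_natl.
  rewrite cB.
  rewrite card_mx natrX exprVn mulrAC mulfV ?mul1r //.
  by rewrite expf_neq0 // pnatr_eq0 cX -lt0n expn_gt0 card_field_gt0.
apply: cvg_big => [|B _]; first exact: add_continuous.
apply: cvg_big => [|p _]; first exact: mul_continuous.
by rewrite cX -size_prod_irr; apply: class_freq_cvg.
Qed.

End MainTerm.

(** * Irreducibles of moderate degree *)

Lemma card_cover (T J : finType) (P : pred T) (Q : J -> pred T) :
  (forall x, P x -> exists j, Q j x) -> (#|P| <= \sum_j #|Q j|)%N.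
Proof.
move=> PQ; rewrite -sum1_card.
rewrite (eq_bigr (fun j => \sum_(x | Q j x) 1)%N); last by move=> j _; rewrite sum1_card.
rewrite (exchange_big_dep xpredT) //= big_mkcond; apply: leq_sum => x _.
case: ifP => // /PQ[j Qj]; rewrite sum1_card; apply/card_gt0P; by exists j.
Qed.

Section Entry.
Variables (T : finType) (k n : nat) (i : 'I_k) (j : 'I_n).
Implicit Types (A : 'M[T]_(k, n)) (P Q : pred 'M[T]_(k, n)).

Definition set_entry A (t : T) : 'M[T]_(k, n) :=
  \matrix_(x, y) if (x == i) && (y == j) then t else A x y.

(* Double counting of the pairs [(A, t)] with [P (set_entry A t)]:
   [(A, t) |-> (set_entry A t, A i j)] is an involution. *)
Lemma card_set_entry P Q c :
    (forall A t, P (set_entry A t) -> Q A) ->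
    (forall A, #|[pred t | P (set_entry A t)]| <= c)%N ->
  (#|P| * #|T| <= c * #|Q|)%N.
Proof.
move=> PQ Pc.
pose h (p : 'M[T]_(k, n) * T) := (set_entry p.1 p.2, p.1 i j).
have hK : involutive h.
  move=> [A t]; rewrite /h /=; congr pair; last by rewrite mxE !eqxx.
  by apply/matrixP => x y; rewrite !mxE; case: ifP => [/andP[/eqP-> /eqP->]|->].
have <- : (\sum_(A : 'M[T]_(k, n)) \sum_(t | P (set_entry A t)) 1 = #|P| * #|T|)%N.
  rewrite pair_big_dep /= (reindex_inj (inv_inj hK)) /=.
  transitivity (\sum_(A : 'M[T]_(k, n) | P A) \sum_(t : T) 1)%N; last first.
    by rewrite -(sum1_card P) big_distrl /=; apply: eq_bigr => A _; rewrite sum1_card mul1n.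
  rewrite pair_big /=; apply: eq_bigl => -[A t] /=.
  by have := hK (A, t); rewrite /h /= andbT => -[->].
rewrite -(sum1_card Q) big_distrr [X in (_ <= X)%N]big_mkcond /=; apply: leq_sum => A _.
rewrite sum1_card muln1; case: ifP => QA; first exact: Pc.
rewrite leqn0; apply/eqP/eq_card0 => t; rewrite inE; apply: contraFF QA; exact: PQ.
Qed.

End Entry.

Section MediumTail.
Variables (F : finFieldType) (T : finType) (tau : T -> {poly F}).
Variables (f : {poly F}) (kappa : nat).
Hypothesis f_irr : monic_irreducible f.
Hypothesis kappaP : forall r, (#|[pred t : T | (f %| tau t - r)%R]| <= kappa)%N.
Let q := #|F|.

(** Since the coefficient at [i] is 1, the relation in a column fixes the residue modulo [f] of the
    entry in row [i], leaving it at most [kappa] values. The induction imposes the relation one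
    column at a time. *)
Lemma card_row_relation k n (w : 'rV[{poly F}]_k) (i : 'I_k) : w 0 i = 1 ->
  (#|[pred A : 'M[T]_(k, n) | [forall y, (f %| (w *m map_mx tau A) 0 y)%R]]| * #|T| ^ n
    <= kappa ^ n * #|'M[T]_(k, n)|)%N.
Proof.
move=> wi.
pose Z (j : nat) := [pred A : 'M[T]_(k, n) |
  [forall y : 'I_n, (y < j)%N ==> (f %| (w *m map_mx tau A) 0 y)%R]].
have -> : #|[pred A : 'M[T]_(k, n) | [forall y, (f %| (w *m map_mx tau A) 0 y)%R]]| = #|Z n|.
  by apply: eq_card => A; rewrite !inE; apply: eq_forallb => y; rewrite ltn_ord.
suff H j : (j <= n)%N -> (#|Z j| * #|T| ^ j <= kappa ^ j * #|'M[T]_(k, n)|)%N by exact: H.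
elim: j => [_|j IH jn]; first by rewrite !expn0 muln1 mul1n max_card.
have step : (#|Z j.+1| * #|T| <= kappa * #|Z j|)%N.
  pose jo := Ordinal jn.
  have relE A t y : (w *m map_mx tau (set_entry i jo A t)) 0 y =
     if y == jo then tau t + \sum_(x | x != i) w 0 x * tau (A x y)
     else (w *m map_mx tau A) 0 y.
    rewrite [LHS]mxE; case: eqP => [->|/eqP yj].
      rewrite (bigD1 i) //= !mxE !eqxx wi mul1r; congr (_ + _).
      by apply: eq_bigr => x xi; rewrite !mxE (negbTE xi).
    by rewrite mxE; apply: eq_bigr => x _; rewrite !mxE (negbTE yj) andbF.
  apply: (card_set_entry (i := i) (j := jo)) => [A t|A].
    move=> /forallP H; apply/forallP => y; apply/implyP => yj.
    have /implyP := H y; rewrite relE ltnS (ltnW yj) => /(_ isT).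
    by rewrite (_ : (y == jo) = false) //; apply/eqP => yE; rewrite yE /= ltnn in yj.
  apply: leq_trans (kappaP (- \sum_(x | x != i) w 0 x * tau (A x jo))).
  apply: subset_leq_card; apply/fintype.subsetP => t; rewrite !inE => /forallP/(_ jo).
  by rewrite ltnS leqnn /= relE eqxx opprK.
apply: (@leq_trans (kappa * #|Z j| * #|T| ^ j)).
  by rewrite expnS mulnA leq_mul2r step orbT.
by rewrite expnS -!mulnA leq_mul2l (IH (ltnW jn)) orbT.
Qed.

(** Dividing a relation by a coefficient invertible modulo [f] normalises that coefficient to 1. The
    union bound runs over its position and over the [k] other coefficients in the residue field. *)
Lemma card_dependent k n :
  (#|[pred A : 'M[T]_(k.+1, n) | `[< dependent_mod f (map_mx tau A) >]]| * #|T| ^ n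
   <= (k.+1 * q ^ ((size f).-1 * k)) * (kappa ^ n * #|'M[T]_(k.+1, n)|))%N.
Proof.
have [K [pi [s [pi0 sK cK]]]] := residue_field f_irr.
pose v (p : 'I_k.+1 * {ffun 'I_k -> K}) : 'rV[{poly F}]_k.+1 :=
  \row_x if unlift p.1 x is Some y then s (p.2 y) else 1.
have cov : (#|[pred A : 'M[T]_(k.+1, n) | `[< dependent_mod f (map_mx tau A) >]]| <=
    \sum_p #|[pred A : 'M[T]_(k.+1, n) | [forall y, (f %| (v p *m map_mx tau A) 0 y)%R]]|)%N.
  apply: card_cover => A /= /asboolP[w [[i wi] wA]].
  have pwi : pi (w 0 i) != 0 by rewrite pi0.
  exists (i, [ffun y => pi (w 0 (lift i y)) / pi (w 0 i)]); apply/forallP => y.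
  have vE x : pi (v (i, [ffun y => pi (w 0 (lift i y)) / pi (w 0 i)]) 0 x) = pi (w 0 x) / pi (w 0 i).
    rewrite mxE /=; case: unliftP => [z ->|->]; first by rewrite ffunE sK.
    by rewrite rmorph1 divff.
  rewrite -pi0 mxE rmorph_sum /=.
  under eq_bigr do rewrite rmorphM vE mulrAC -rmorphM.
  rewrite -mulr_suml -rmorph_sum mulf_eq0 pi0.
  by have := wA y; rewrite mxE => ->.
apply: leq_trans (_ : (\sum_p #|[pred A : 'M[T]_(k.+1, n) |
   [forall y, (f %| (v p *m map_mx tau A) 0 y)%R]]|) * #|T| ^ n <= _)%N.
  by rewrite leq_mul2r cov orbT.
rewrite big_distrl /=.
have -> : (k.+1 * q ^ ((size f).-1 * k) = #|{: 'I_k.+1 * {ffun 'I_k -> K}}|)%N.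
  by rewrite card_prod card_ord card_ffun card_ord cK expnM.
rewrite -sum_nat_const; apply: leq_sum => p _.
by apply: (@card_row_relation _ _ _ p.1); rewrite mxE unlift_none.
Qed.

End MediumTail.

(** * Irreducibles of large degree *)

Section Divisors.
Variable F : finFieldType.
Implicit Types (f p : {poly F}).

Lemma irreducible_Gauss f p r : monic_irreducible f -> (f %| p * r) = (f %| p) || (f %| r).
Proof. by move=> fi; exact: (monic_irr_Gauss (exist _ f fi)). Qed.

Lemma dvdp_sum f (I : Type) (r : seq I) (P : pred I) (h : I -> {poly F}) :
  (forall i, P i -> f %| h i) -> f %| \sum_(i <- r | P i) h i.
Proof.
move=> H; apply: (big_ind (fun x => f %| x)) => [|x y|]; [exact: dvdp0 | exact: dvdp_add | exact: H].
Qed.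

(** Large irreducible factors are split off one by one; each lowers the size of [p] by
    [(size f).-1], which is at least [L]. *)
Lemma large_divisors L p : p != 0 -> exists s : seq {poly F},
  (size s * L < size p)%N /\
  forall f, monic_irreducible f -> (L < size f)%N -> f %| p -> f \in s.
Proof.
have [N] := ubnP (size p); elim: N p => // N IH p; rewrite ltnS => pN p0.
have [[f [fi Lf /dvdpP[r rE]]]|H] := pselect (exists f,
    [/\ monic_irreducible f, (L < size f)%N & f %| p]); last first.
  exists [::]; split; first by rewrite size_poly_gt0.
  by move=> f fi Lf fp; case: H; exists f.
have [[f1 _] fm] := monic_irreducibleP fi.
have r0 : r != 0 by apply: contraNneq p0 => r0; rewrite rE r0 mul0r.
have sp : size p = (size r + (size f).-1)%N.
  by rewrite rE size_Mmonic // -(prednK (ltnW f1)) addnS.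
have f1' : (0 < (size f).-1)%N by rewrite -ltnS prednK // ltnW.
have [|s [sL sP]] := IH r _ r0.
  by rewrite (leq_trans _ pN) // sp -[X in (X < _)%N]addn0 ltn_add2l.
exists (f :: s); split.
  rewrite /= mulSn addnC sp -addSn leq_add // -ltnS prednK // ltnW //.
move=> h hi Lh; rewrite rE irreducible_Gauss // inE => /orP[/(sP h hi Lh)->|hf].
  by rewrite orbT.
by have := monic_irr_dvd (exist _ h hi) (exist _ f fi); rewrite /= hf => /esym/eqP[->]; rewrite eqxx.
Qed.

(** Leibniz expansion: every term is a product of [j] entries of degree at most [L.-1]. The
    predecessor of the size plays the role of the degree, with value 0 at the zero polynomial. *)
Lemma size_det_le L j (M : 'M[{poly F}]_j) :
  (forall x y, size (M x y) <= L)%N -> ((size (\det M)).-1 <= j * L.-1)%N.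
Proof.
move=> ML; rewrite -subn1 leq_subLR add1n.
apply: (leq_trans (size_sum _ _ _)); apply/bigmax_leqP => s _.
rewrite size_Msign -add1n -leq_subLR subn1.
rewrite -[X in (X * _)%N]card_ord -sum_nat_const.
apply: (big_ind2 (fun (x : {poly F}) y => (size x).-1 <= y)%N).
- by rewrite size_poly1.
- move=> x1 y1 x2 y2 h1 h2; apply: leq_trans (leq_add h1 h2).
  have := size_polyMleq x1 x2.
  by move: (size x1) (size x2) (size (x1 * x2)%R) => a b c; lia.
- by move=> x _; have := ML x (s x); move: (size _) => a; lia.
Qed.

(** Multiplying the relation by the adjugate gives the determinant times [w], and [f] does not
    divide some entry of [w]. *)
Lemma dependent_det f j (M : 'M[{poly F}]_j) : monic_irreducible f ->
  dependent_mod f M -> f %| \det M.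
Proof.
move=> fi [w [[i wi] wM]].
have : f %| (w *m M *m \adj M) 0 i.
  by rewrite mxE; apply: dvdp_sum => y _; rewrite dvdp_mulr.
by rewrite -mulmxA mul_mx_adj mul_mx_scalar mxE irreducible_Gauss // (negbTE wi) orbF.
Qed.

(** Indexing by natural numbers lets relations among different numbers of rows be compared without
    casts. *)
Lemma dependent_matrixP f j l (a : nat -> nat -> {poly F}) :
  dependent_mod f (\matrix_(x < j, y < l) a x y) <->
  exists w : nat -> {poly F}, (exists2 x, (x < j)%N & ~~ (f %| w x)) /\
    forall y, (y < l)%N -> f %| \sum_(x < j) w x * a x y.
Proof.
split=> [[w [[i wi] wA]]|[w [[i ij wi] wA]]].
  exists (fun x => if insub x is Some i then w 0 i else 0); split.
    by exists i => //; rewrite valK.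
  move=> y yl; have := wA (Ordinal yl); rewrite mxE.
  by under eq_bigr do rewrite mxE /=; under [in X in _ -> X]eq_bigr do rewrite valK.
exists (\row_x w x); split; first by exists (Ordinal ij); rewrite mxE.
by move=> y; rewrite mxE; under eq_bigr do rewrite !mxE; exact: wA.
Qed.

(** The determinant is affine in a single entry, with slope the cofactor, which does not involve
    that entry. *)
Lemma det_entry j (M M' : 'M[{poly F}]_j) x y :
  (forall x' y', (x' != x) || (y' != y) -> M x' y' = M' x' y') ->
  \det M - \det M' = (M x y - M' x y) * cofactor M x y.
Proof.
move=> MM'.
have cof y' : cofactor M' x y' = cofactor M x y'.
  rewrite /cofactor; congr (_ * \det _); apply/matrixP => a b; rewrite !mxE.
  by apply/esym/MM'; rewrite eq_sym neq_lift.
rewrite !(expand_det_row _ x) -sumrB (bigD1 y) //= big1 ?addr0.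
  by rewrite cof -mulrBl.
by move=> y' yy'; rewrite cof MM' ?yy' ?orbT // subrr.
Qed.

End Divisors.

Section LargeTail.
Variables (F : finFieldType) (T : finType) (tau : T -> {poly F}) (L k n : nat).
Hypothesis tau_inj : injective tau.
Hypothesis size_tau : forall t, (size (tau t) <= L)%N.
Hypothesis L_gt0 : (0 < L)%N.
Implicit Types (A : 'M[T]_(k.+1, n.+1)) (f : {poly F}).

Definition entry A (x y : nat) : {poly F} := tau (A (inord x) (inord y)).

Definition top j l A : 'M[{poly F}]_(j, l) := \matrix_(x < j, y < l) entry A x y.

Definition top_singular j A := \det (top j j A) == 0.

(** There is one column more than rows: the square part confines [f] to the divisors of its
    determinant, and the last column restricts one more entry. *)
Definition top_dependent j A := `[< exists f,
  [/\ monic_irreducible f, (L < size f)%N & dependent_mod f (top j j.+1 A)] >].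

Lemma entry_set A i j t x y : (i <= k)%N -> (j <= n)%N -> (x <= k)%N -> (y <= n)%N ->
  entry (set_entry (inord i) (inord j) A t) x y =
  if (x == i) && (y == j) then tau t else entry A x y.
Proof.
move=> ik jn xk yn; rewrite /entry mxE -!val_eqE /= !inordK ?ltnS //.
by case: ifP.
Qed.

Lemma top_set A i j t j1 l : (i <= k)%N -> (j <= n)%N -> (j1 <= k.+1)%N -> (l <= n.+1)%N ->
  (j1 <= i)%N || (l <= j)%N ->
  top j1 l (set_entry (inord i) (inord j) A t) = top j1 l A.
Proof.
move=> ik jn jk ln out; apply/matrixP => x y; rewrite !mxE entry_set //.
- case: andP => // -[/eqP xi /eqP yj].
  by have := ltn_ord x; have := ltn_ord y; rewrite xi yj; lia.
- by rewrite -ltnS (leq_trans (ltn_ord x)).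
- by rewrite -ltnS (leq_trans (ltn_ord y)).
Qed.

Lemma cofactor_top j A : cofactor (top j.+1 j.+1 A) ord_max ord_max = \det (top j j A).
Proof.
rewrite /cofactor -signr_odd oddD addbb expr0 mul1r; congr (\det _).
by apply/matrixP => x y; rewrite !mxE !lift_max.
Qed.

(** When the minor of size [j] is nonzero, the next one is affine in its corner entry with that
    minor as slope, so at most one value of the entry makes it vanish. *)
Lemma card_top_singular j : (j <= k.+1)%N -> (j <= n.+1)%N ->
  (#|top_singular j| * #|T| <= j * #|'M[T]_(k.+1, n.+1)|)%N.
Proof.
elim: j => [_ _|j IH jk jn].
  rewrite eq_card0 ?mul0n // => A.
  by rewrite -[LHS]/(top_singular 0 A) /top_singular det_mx00 oner_eq0.
pose P := [pred A | top_singular j.+1 A && ~~ top_singular j A].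
have step : (#|P| * #|T| <= 1 * #|'M[T]_(k.+1, n.+1)|)%N.
  apply: (card_set_entry (i := inord j) (j := inord j) (Q := predT)) => // A.
  apply/fintype.card_le1_eqP => t' t; rewrite !inE.
  rewrite /top_singular => /andP[/eqP dt' _] /andP[/eqP dt nz].
  apply/tau_inj/eqP; rewrite -subr_eq0.
  have ME x y : (x != ord_max) || (y != ord_max) ->
      top j.+1 j.+1 (set_entry (inord j) (inord j) A t) x y =
      top j.+1 j.+1 (set_entry (inord j) (inord j) A t') x y.
    rewrite !mxE -!val_eqE /= -negb_and => xy.
    have xk : (x <= k)%N by rewrite -ltnS (leq_trans (ltn_ord x)).
    have yn : (y <= n)%N by rewrite -ltnS (leq_trans (ltn_ord y)).
    by rewrite !entry_set // (negbTE xy).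
  have := det_entry ME.
  rewrite dt dt' subrr cofactor_top ![top j.+1 j.+1 _ ord_max ord_max]mxE.
  rewrite !entry_set // !eqxx /=.
  by move/esym/eqP; rewrite mulf_eq0 (negbTE nz) orbF.
have cov : (#|top_singular j.+1| <= #|top_singular j| + #|P|)%N.
  rewrite -(cardID (top_singular j)) leq_add //.
    by apply: subset_leq_card; apply/fintype.subsetP => A; rewrite !inE => /andP[].
  by apply: subset_leq_card; apply/fintype.subsetP => A; rewrite !inE andbC.
apply: (@leq_trans ((#|top_singular j| + #|P|) * #|T|)); first by rewrite leq_mul2r cov orbT.
rewrite mulnDl mulSn addnC; apply: leq_add; first by rewrite mul1n in step.
by rewrite IH // ltnW.
Qed.

(** Relations [w] for [t] and [v] for [t'] have last coefficients prime to [f], otherwise the first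
    [j] rows would be dependent. Eliminating row [j] gives the relation [u] among those rows, so [f]
    divides [u]. The last column then shows that [f] divides [tau t - tau t'], whose size is too
    small unless it vanishes. *)
Lemma top_dependent_unique j A t t' f : (j <= k)%N -> (j < n)%N ->
    monic_irreducible f -> (L < size f)%N ->
    ~ dependent_mod f (top j j.+1 A) ->
    dependent_mod f (top j.+1 j.+2 (set_entry (inord j) (inord j.+1) A t)) ->
    dependent_mod f (top j.+1 j.+2 (set_entry (inord j) (inord j.+1) A t')) ->
  t = t'.
Proof.
move=> jk jn fi Lf nd.
pose c x := entry A x j.+1.
have entlt z y u : (z < j)%N -> (y <= n)%N ->
    entry (set_entry (inord j) (inord j.+1) A u) z y = entry A z y.
  move=> zj yn; have zk : (z <= k)%N by rewrite ltnW // (leq_trans zj).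
  by rewrite entry_set // (ltn_eqF zj).
have rel u : dependent_mod f (top j.+1 j.+2 (set_entry (inord j) (inord j.+1) A u)) ->
  exists w : nat -> {poly F}, [/\ ~~ (f %| w j),
    forall y, (y < j.+1)%N -> f %| \sum_(x < j) w x * entry A x y + w j * entry A j y
    & f %| \sum_(x < j) w x * c x + w j * tau u].
  move=> /dependent_matrixP[w [[x xj wx] wA]]; exists w.
  have w1 y : (y < j.+1)%N -> f %| \sum_(x < j) w x * entry A x y + w j * entry A j y.
    move=> yj; have := wA y (leqW yj); rewrite big_ord_recr /=.
    have yn : (y <= n)%N by rewrite ltnW // (leq_trans yj).
    rewrite entry_set // (ltn_eqF yj) andbF.
    by rewrite (eq_bigr (fun z : 'I_j => w z * entry A z y)) // => z _; rewrite entlt.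
  have w2 : f %| \sum_(x < j) w x * c x + w j * tau u.
    have := wA j.+1 (ltnSn _); rewrite big_ord_recr /=.
    rewrite entry_set // !eqxx /=.
    by rewrite (eq_bigr (fun z : 'I_j => w z * c z)) // => z _; rewrite entlt.
  split=> //; apply/negP => fwj; apply: nd; apply/dependent_matrixP; exists w; split.
    exists x => //; rewrite ltn_neqAle -ltnS xj andbT.
    by apply: contraNneq wx => ->.
  by move=> y yj; have := w1 y yj; rewrite dvdp_addl // dvdp_mulr.
move=> /rel[w [wj w1 w2]] /rel[v [vj v1 v2]].
pose u x := v j * w x - w j * v x.
have comb (a : nat -> {poly F}) b b' :
    v j * (\sum_(x < j) w x * a x + w j * b) - w j * (\sum_(x < j) v x * a x + v j * b') =
    \sum_(x < j) u x * a x + v j * w j * (b - b').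
  rewrite !mulrDr !mulr_sumr opprD addrACA; congr (_ + _); last by ring.
  by rewrite -sumrB; apply: eq_bigr => x _; rewrite /u; ring.
have fu x : (x < j)%N -> f %| u x.
  move=> xj; apply/negPn/negP => fux; apply: nd; apply/dependent_matrixP; exists u.
  split=> [|y yj]; first by exists x.
  have := comb (entry A ^~ y) (entry A j y) (entry A j y).
  by rewrite subrr mulr0 addr0 => <-; rewrite dvdp_sub // dvdp_mull ?w1 ?v1.
have : f %| \sum_(x < j) u x * c x + v j * w j * (tau t - tau t').
  by rewrite -comb dvdp_sub // dvdp_mull.
rewrite dvdp_addr; last by apply: dvdp_sum => x _; rewrite dvdp_mulr // fu.
rewrite !irreducible_Gauss // (negbTE wj) (negbTE vj) /= => ft.
apply/tau_inj/eqP; rewrite -subr_eq0; apply: contraTT ft => tt'.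
apply/negP => /(dvdp_leq tt'); rewrite leqNgt (leq_ltn_trans _ Lf) //.
by rewrite (leq_trans (size_polyD _ _)) // size_polyN geq_max !size_tau.
Qed.

(** The varied entry lies outside the square minor [D], which [f] must divide. A nonzero [D] has at
    most [j.+1] irreducible divisors of size above [L], and by [top_dependent_unique] each of them
    accounts for at most one value of the entry. *)
Lemma card_top_dependent_step j : (j <= k)%N -> (j < n)%N ->
  (#|[pred A | [&& top_dependent j.+1 A, ~~ top_dependent j A & ~~ top_singular j.+1 A]]| * #|T|
    <= j.+1 * #|'M[T]_(k.+1, n.+1)|)%N.
Proof.
move=> jk jn.
apply: (card_set_entry (i := inord j) (j := inord j.+1) (Q := predT)) => // A.
have topA t l l' : (l <= j)%N || (l' <= j.+1)%N -> (l <= j.+1)%N -> (l' <= n.+1)%N ->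
    top l l' (set_entry (inord j) (inord j.+1) A t) = top l l' A.
  by move=> out lj ln; apply: top_set => //; rewrite (leq_trans lj).
pose D := \det (top j.+1 j.+1 A).
have [D0|D0] := eqVneq D 0.
  rewrite eq_card0 // => t; rewrite !inE /top_singular topA ?leqnn ?orbT // 1?ltnW //.
  by rewrite -/D D0 eqxx !andbF.
have [s [sL sP]] := large_divisors L D0.
have Ds : ((size D).-1 <= j.+1 * L.-1)%N.
  by apply: size_det_le => x y; rewrite mxE /entry.
have sj : (size s <= j.+1)%N.
  rewrite -(leq_pmul2r L_gt0); apply: leq_trans (_ : (size D).-1 <= _)%N.
    by rewrite -ltnS prednK // (leq_ltn_trans _ sL).
  by rewrite (leq_trans Ds) // leq_mul2l leq_pred orbT.
apply: leq_trans sj.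
set P := [pred t | _].
have /choice[phi phiP] : forall t, exists f, P t -> [/\ f \in s, monic_irreducible f, (L < size f)%N,
    ~ dependent_mod f (top j j.+1 A)
    & dependent_mod f (top j.+1 j.+2 (set_entry (inord j) (inord j.+1) A t))].
  move=> t; have [/= /and3P[/asboolP[f [fi Lf fd]] nd _]|] := boolP (P t); last by exists 0.
  exists f => _; split=> //.
    apply: sP => //; apply: dependent_det => //.
    have [w [wi wA]] := fd; exists w; split=> // y.
    have := wA (widen_ord (leqnSn _) y); rewrite !mxE.
    rewrite -(topA t j.+1 j.+1) ?leqnn ?orbT // 1?ltnW //.
    by congr (_ %| _); apply: eq_bigr => x _; rewrite !mxE.
  move=> fd'; move/negP: nd; apply; apply/asboolP; exists f; split=> //.
  by rewrite topA ?leqnn // ltnS ltnW.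
rewrite cardE -(size_map phi); apply: uniq_leq_size.
  rewrite map_inj_in_uniq ?enum_uniq // => t t'; rewrite !mem_enum => Pt Pt' tt'.
  have [_ fi Lf nd fd] := phiP t Pt; have [_ _ _ _] := phiP t' Pt'; rewrite -tt' => fd'.
  exact: top_dependent_unique fd fd'.
by move=> f /mapP[t]; rewrite mem_enum => Pt ->; have [] := phiP t Pt.
Qed.

(** Passing to [j.+1] adds [j.+1] for a vanishing minor and [j.+1] for a new dependence, and
    [j * j.+1 + 2 * j.+1 = j.+1 * j.+2]. *)
Lemma card_top_dependent j : (j <= k.+1)%N -> (j <= n)%N ->
  (#|top_dependent j| * #|T| <= (j * j.+1) * #|'M[T]_(k.+1, n.+1)|)%N.
Proof.
elim: j => [_ _|j IH jk jn].
  rewrite eq_card0 ?mul0n // => A; rewrite inE; apply/negP => /asboolP[f [_ _]].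
  by case=> w [[[]]].
set P := [pred A | [&& top_dependent j.+1 A, ~~ top_dependent j A & ~~ top_singular j.+1 A]].
have cov : (#|top_dependent j.+1| <= #|top_dependent j| + (#|top_singular j.+1| + #|P|))%N.
  rewrite -(cardID (top_dependent j)) leq_add //.
    by apply: subset_leq_card; apply/fintype.subsetP => A /andP[].
  rewrite -(cardID (top_singular j.+1)) leq_add //.
    by apply: subset_leq_card; apply/fintype.subsetP => A /andP[].
  apply: subset_leq_card; apply/fintype.subsetP => A /andP[H1 /andP[H2 H3]].
  by apply/and3P; split.
apply: (@leq_trans ((#|top_dependent j| + (#|top_singular j.+1| + #|P|)) * #|T|)).
  by rewrite leq_mul2r cov orbT.
have h1 := IH (ltnW jk) (ltnW jn).
have h2 := card_top_singular jk (leqW jn).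
have h3 := card_top_dependent_step jk jn; rewrite -/P in h3.
rewrite !mulnDl (leq_trans (leq_add h1 (leq_add h2 h3))) // -!mulnDl leq_mul2r.
by apply/orP; right; lia.
Qed.

(** A dependence of the full rows restricts to the first [k.+2] columns, which exist because
    [k < n]. *)
Lemma card_large_dependent : (k < n)%N ->
  (#|[pred A : 'M[T]_(k.+1, n.+1) | `[< exists f, [/\ monic_irreducible f, (L < size f)%N
       & dependent_mod f (map_mx tau A)] >]]| * #|T|
    <= (k.+1 * k.+2) * #|'M[T]_(k.+1, n.+1)|)%N.
Proof.
move=> kn; apply: leq_trans (card_top_dependent (leqnn _) kn).
rewrite leq_mul2r; apply/orP; right; apply: subset_leq_card.
apply/fintype.subsetP => A /asboolP[f [fi Lf [w [wi wA]]]]; apply/asboolP; exists f; split=> //.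
exists w; split=> // y; have yn : (y < n.+1)%N by rewrite (leq_trans (ltn_ord y)).
have := wA (inord y); rewrite !mxE; congr (_ %| _); apply: eq_bigr => x _.
by rewrite !mxE /entry inord_val.
Qed.

End LargeTail.

(** * Frequencies in boxes *)

Section Density.
Variables (R : realType) (F : finFieldType) (e : 'I_#|F| -> F).
Hypothesis e_bij : bijective e.
Hypothesis e0 : forall i : 'I_#|F|, val i = 0%N -> e i = 0.
Let q := #|F|.

Let q_gt1 : 1 < q%:R :> R. Proof. by rewrite ltr1n card_field_gt1. Qed.
Let q_gt0 : 0 < q%:R :> R. Proof. exact: lt_trans q_gt1. Qed.

(** Since the enumeration is injective, counting matrices in the box amounts to counting matrices of
    indices. *)
Lemma box_freqE k n N (S : set 'M[{poly F}]_(k, n)) :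
  #|` fset_set (S `&` @box F e k n N)|%:R / #|` fset_set (@box F e k n N)|%:R =
  box_freq R e N (fun A => `[< S A >]).
Proof.
have card_box (P : pred 'M['I_N.+1]_(k, n)) (V : set 'M[{poly F}]_(k, n)) :
    (forall A, V A <-> exists2 B, P B & A = box_mx e B) -> #|` fset_set V| = #|P|.
  move=> VP.
  have finV : finite_set V.
    apply: (sub_finite_set _ (finite_image (@box_mx F e k n N) (@finite_finset _ [set: 'M['I_N.+1]_(k, n)]))).
    by move=> A /VP[B _ ->]; exists B.
  have box_inj : injective (@box_mx F e k n N).
    move=> A B AB; apply/matrixP => i j; apply/val_inj/(enum_poly_inj e_bij e0).
    by have := congr1 (fun M : 'M[{poly F}]_(k, n) => M i j) AB; rewrite !mxE.
  rewrite cardE -(size_map (@box_mx F e k n N)); apply: perm_size; apply: uniq_perm.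
  - exact: fset_uniq.
  - by rewrite map_inj_uniq // enum_uniq.
  move=> A; rewrite in_fset_set //; apply/idP/mapP => [|[B]].
    by rewrite inE => /VP[B PB ->]; exists B => //; rewrite mem_enum.
  by rewrite mem_enum => PB ->; rewrite inE; apply/VP; exists B.
rewrite /box_freq (card_box [pred A | `[< S (box_mx e A) >]]) ?(card_box predT) //.
  move=> A; split=> [Abox|[B _ ->] i j]; last first.
    by exists (B i j); rewrite ?mxE // -ltnS.
  have /choice[h hP] : forall p : 'I_k * 'I_n, exists m : 'I_N.+1, A p.1 p.2 = enum_poly e m.
    by move=> [i j]; have [m mN AE] := Abox i j; exists (Ordinal (mN : (m < N.+1)%N)).
  exists (\matrix_(i, j) h (i, j)) => //; apply/matrixP => i j; rewrite !mxE.
  by rewrite -hP.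
move=> A; split=> [[SA Abox]|[B /asboolP SB ->]]; last first.
  by split=> // i j; exists (B i j); rewrite ?mxE // -ltnS.
have /choice[h hP] : forall p : 'I_k * 'I_n, exists m : 'I_N.+1, A p.1 p.2 = enum_poly e m.
  by move=> [i j]; have [m mN AE] := Abox i j; exists (Ordinal (mN : (m < N.+1)%N)).
have AE : A = box_mx e (\matrix_(i, j) h (i, j)).
  by apply/matrixP => i j; rewrite !mxE -hP.
by exists (\matrix_(i, j) h (i, j)) => //; apply/asboolP; rewrite -AE.
Qed.

Lemma prod_local_density k n d : (k <= n)%N ->
  \prod_(f <- irr_le F d) local_density R k n f =
  \prod_(i < k) euler_prod (irr_le F d) (q%:R^-1 ^+ (n - i)).
Proof.
move=> kn; rewrite /local_density exchange_big /=; apply: eq_bigr => i _.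
by apply: eq_bigr => f _; rewrite exprM.
Qed.

(** Exchanging the products leaves, for each [i < k], an Euler product at [q ^ -(n - i)], with limit
    [1 - q ^ -(n - i - 1)]. The target is reindexed in reverse to match. *)
Lemma prod_local_density_cvg k n : (k <= n)%N ->
  \prod_(f <- irr_le F d) local_density R k n f @[d --> \oo] -->
  \prod_(n - k <= i < n) (1 - (q%:R ^+ i)^-1 : R).
Proof.
move=> kn; under eq_fun do rewrite prod_local_density //.
rewrite -{1}[(n - k)%N]add0n big_addn subKn // big_nat_rev /= big_mkord.
apply: cvg_big => [|i _]; first exact: mul_continuous.
have in_ : (i < n)%N by rewrite (leq_trans (ltn_ord i)).
have -> : (0 + k - i.+1 + (n - k) = (n - i).-1)%N by have := ltn_ord i; lia.
have -> : (q%:R ^+ (n - i).-1)^-1 = q%:R * q%:R^-1 ^+ (n - i) :> R.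
  rewrite -[in RHS](prednK (_ : 0 < n - i)%N) ?subn_gt0 //= exprS mulrA mulfV ?mul1r ?exprVn //.
  by rewrite gt_eqF.
have qV : 0 <= q%:R^-1 :> R by rewrite invr_ge0 ltW.
apply: euler_prod_irr_le_cvg; first by rewrite exprn_ge0.
rewrite -(prednK (_ : 0 < n - i)%N) ?subn_gt0 //= exprS mulrA mulfV ?mul1r ?gt_eqF //.
by rewrite exprn_ile1 // invf_le1 // ltW.
Qed.

Lemma geometric_tail d m :
  \sum_(i < m.+1 | (d < i)%N) (q%:R ^+ i)^-1 <= (q%:R ^+ d)^-1 :> R.
Proof.
(* The remainder makes the bound inductive; [maxn] makes the right side 0 when [m <= d], where the
   sum is empty. *)
suff H : \sum_(i < m.+1 | (d < i)%N) (q%:R ^+ i)^-1 <=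
    (q%:R ^+ d)^-1 - (q%:R ^+ maxn d m)^-1 :> R.
  by apply: le_trans H _; rewrite gerBl invr_ge0 exprn_ge0 // ltW.
elim: m => [|m IH].
  by rewrite big_mkcond big_ord_recr big_ord0 /= addr0 maxn0 subrr.
rewrite big_mkcond big_ord_recr -big_mkcond /=.
case: ltnP => dm; last first.
  by rewrite addr0 (le_trans IH) // !(maxn_idPl _) // ltnW.
apply: le_trans (lerD IH (lexx _)) _.

have -> : maxn d m = m by lia.
rewrite exprS invfM.
have qm : 0 <= (q%:R ^+ m)^-1 :> R by rewrite invr_ge0 exprn_ge0 // ltW.
have q2 : q%:R^-1 + q%:R^-1 <= 1 :> R.
  have q2 : 2%:R <= q%:R :> R by rewrite ler_nat card_field_gt1.
  rewrite -(ler_pM2r q_gt0) mulrDl mulVf ?gt_eqF // mul1r; lra.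
nra.
Qed.

(** With [Q = q ^ deg f <= N], a class modulo [f] has frequency at most [2 / Q]. The [Q ^ k]
    normalised relations, each costing [(2 / Q) ^ n.+1], leave at least two powers of [1 / Q]
    because [k < n]: one absorbs the sum over polynomials of a given degree, the other makes the sum
    over degrees converge. *)
Lemma dependent_freq k n N (f : {poly F}) : monic_irreducible f -> (k < n)%N ->
  (q ^ (size f).-1 <= N)%N ->
  box_freq R e N (fun A : 'M[{poly F}]_(k.+1, n.+1) => `[< dependent_mod f A >]) <=
    (k.+1 * 2 ^ n.+1)%:R * (q%:R ^+ (size f).-1)^-1 ^+ 2.
Proof.
move=> fi kn QN; have [_ fm] := monic_irreducibleP fi.
set E := (size f).-1 in QN *.
have := card_dependent fi (class_count_le e_bij e0 fm N) k n.+1.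
rewrite -/q -/E card_ord => H.
set M := #|'M['I_N.+1]_(k.+1, n.+1)| in H *.
set X := #|_| in H *.
set kap := (N %/ q ^ E + 1)%N in H.
have M0 : 0 < M%:R :> R by rewrite ltr0n /M card_mx card_ord expn_gt0.
have u0 : 0 < N.+1%:R :> R by rewrite ltr0n.
pose Q : R := q%:R ^+ E.
have Q1 : 1 <= Q by rewrite /Q exprn_ege1 // ltW.
have Q0 : 0 < Q by rewrite (lt_le_trans ltr01).
have kapQ : kap%:R <= 2 * N.+1%:R / Q.
  rewrite ler_pdivlMr // /Q -natrX -!natrM ler_nat /kap mulnDl mul1n mulnS.
  rewrite (leq_trans (leq_add (leq_trunc_div _ _) QN)) // addnn -mul2n.
  by rewrite leq_addl.
have Xr : X%:R * N.+1%:R ^+ n.+1 <= (k.+1%:R * Q ^+ k) * (kap%:R ^+ n.+1 * M%:R).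
  by rewrite /Q -exprM -!natrX -!natrM ler_nat.
have QQ : Q ^+ k * (Q ^+ n.+1)^-1 <= (Q ^+ 2)^-1.
  have -> : n.+1 = (k + (2 + (n - k.+1)))%N by lia.
  rewrite exprD invfM mulrA divff ?mul1r ?expf_neq0 ?gt_eqF // exprD invfM.
  by rewrite ler_piMr ?invr_ge0 ?exprn_ge0 ?(ltW Q0) // invf_le1 ?exprn_gt0 // exprn_ege1.
rewrite -/(box_mx e) -/X ler_pdivrMr // -(ler_pM2r (exprn_gt0 n.+1 u0)).
apply: (le_trans Xr); rewrite -/Q.
have kapX : kap%:R ^+ n.+1 <= (2 * N.+1%:R / Q) ^+ n.+1.
  by rewrite lerXn2r // ?nnegrE // divr_ge0 ?mulr_ge0 // ltW.
apply: (@le_trans _ _ ((k.+1%:R * Q ^+ k) * ((2 * N.+1%:R / Q) ^+ n.+1 * M%:R))).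
  by rewrite ler_pM2l ?ler_pM2r // mulr_gt0 ?exprn_gt0.
rewrite !exprMn !exprVn natrM natrX -/M.
have -> : k.+1%:R * Q ^+ k * (2 ^+ n.+1 * N.+1%:R ^+ n.+1 / Q ^+ n.+1 * M%:R) =
   (k.+1%:R * 2 ^+ n.+1) * (Q ^+ k * (Q ^+ n.+1)^-1) * M%:R * N.+1%:R ^+ n.+1 by ring.
rewrite ler_pM2r ?exprn_gt0 // ler_pM2r // ler_pM2l // mulr_gt0 // exprn_gt0 //.
Qed.

Lemma box_freq_cover k n N (J : finType) (P : pred 'M[{poly F}]_(k, n))
    (Q : J -> pred 'M[{poly F}]_(k, n)) :
  (forall A, P A -> exists j, Q j A) -> box_freq R e N P <= \sum_j box_freq R e N (Q j).
Proof.
move=> PQ; rewrite /box_freq -mulr_suml -natr_sum ler_wpM2r ?invr_ge0 // ler_nat.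
by apply: card_cover => A /PQ.
Qed.

Lemma box_freq_mono k n N (P Q : pred 'M[{poly F}]_(k, n)) :
  (forall A, P A -> Q A) -> box_freq R e N P <= box_freq R e N Q.
Proof.
move=> PQ; rewrite /box_freq ler_wpM2r ?invr_ge0 // ler_nat.
by apply: subset_leq_card; apply/fintype.subsetP => A /PQ.
Qed.

Lemma box_freq_ge0 k n N (P : pred 'M[{poly F}]_(k, n)) : 0 <= box_freq R e N P.
Proof. by rewrite /box_freq divr_ge0. Qed.

Lemma box_freq_pred0 k n N (P : pred 'M[{poly F}]_(k, n)) : (forall A, ~~ P A) ->
  box_freq R e N P = 0.
Proof.
move=> P0; rewrite /box_freq eq_card0 ?mul0r // => A.
by rewrite -[LHS]/(P (box_mx e A)) (negbTE (P0 _)).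
Qed.

Definition has_bad_factor k n (d : nat) (A : 'M[{poly F}]_(k, n)) : bool :=
  `[< exists f, [/\ monic_irreducible f, (d.+1 < size f)%N & dependent_mod f A] >].

Lemma degree_freq k n N i : (k < n)%N -> (q ^ i <= N)%N ->
  box_freq R e N (fun A : 'M[{poly F}]_(k.+1, n.+1) =>
    `[< exists f, [/\ monic_irreducible f, size f = i.+1 & dependent_mod f A] >]) <=
  (k.+1 * 2 ^ n.+1)%:R * (q%:R ^+ i)^-1.
Proof.
move=> kn iN.
pose P (v : {poly_i F}) (A : 'M[{poly F}]_(k.+1, n.+1)) :=
  monic_irreducible (monic_of v) && `[< dependent_mod (monic_of v) A >].
apply: le_trans (box_freq_cover N (Q := P) _) _.
  move=> A /asboolP[f [fi fs fd]].
  have [v vE] := monic_ofP (monic_irreducibleP fi).2 fs.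
  by exists v; rewrite /P -vE fi; apply/asboolP.
have H v : box_freq R e N (P v) <= (k.+1 * 2 ^ n.+1)%:R * (q%:R ^+ i)^-1 ^+ 2.
  have [vi|vi] := boolP (monic_irreducible (monic_of v)); last first.
    rewrite box_freq_pred0 ?mulr_ge0 ?exprn_ge0 ?invr_ge0 ?exprn_ge0 //.
    by move=> A; rewrite /P (negbTE vi).
  apply: le_trans (box_freq_mono (Q := fun A => `[< dependent_mod (monic_of v) A >]) _ _) _.
    by move=> A /andP[].
  by have := dependent_freq vi kn; rewrite size_monic_of; apply.
apply: (@le_trans _ _ (\sum_(v : {poly_i F}) (k.+1 * 2 ^ n.+1)%:R * (q%:R ^+ i)^-1 ^+ 2)).
  by apply: ler_sum => v _; exact: H.
rewrite sumr_const card_npoly -[X in X <= _]mulr_natr natrX -mulrA ler_wpM2l //.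
by rewrite expr2 -mulrA mulVf ?mulr1 // expf_neq0 // gt_eqF.
Qed.

(** The degrees are split at [m], the largest integer with [q ^ m <= N]. Degrees above [d] and up to
    [m] contribute a geometric tail. Beyond, [N < q ^ m.+1] bounds the size of every entry by
    [L = m.+1], and [card_large_dependent] applies. *)
Lemma bad_factor_freq k n d N : (k < n)%N -> (0 < N)%N ->
  box_freq R e N (@has_bad_factor k.+1 n.+1 d) <=
    (k.+1 * 2 ^ n.+1)%:R * (q%:R ^+ d)^-1 + (k.+1 * k.+2)%:R / N.+1%:R.
Proof.
move=> kn N0; pose m := trunc_log q N.
have mN : (q ^ m <= N)%N by apply: trunc_logP N0; exact: card_field_gt1.
have Nm : (N < q ^ m.+1)%N by apply: trunc_log_ltn; exact: card_field_gt1.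
pose P (i : nat) (A : 'M[{poly F}]_(k.+1, n.+1)) :=
  `[< exists f, [/\ monic_irreducible f, size f = i.+1 & dependent_mod f A] >].
pose med (A : 'M[{poly F}]_(k.+1, n.+1)) := [exists i : 'I_m.+1, (d < i)%N && P i A].
apply: le_trans (box_freq_cover N (Q := fun b : bool => if b then med else @has_bad_factor k.+1 n.+1 m) _) _.
  move=> A /asboolP[f [fi df fd]]; have [fm|fm] := ltnP m.+1 (size f).
    by exists false; apply/asboolP; exists f.
  have [[f1 _] _] := monic_irreducibleP fi.
  have fsE : (size f).-1.+1 = size f by rewrite prednK // ltnW.
  have fm' : ((size f).-1 < m.+1)%N by rewrite fsE.
  exists true; apply/existsP; exists (Ordinal fm') => /=.
  by rewrite -ltnS fsE df; apply/asboolP; exists f.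
rewrite big_bool; apply: lerD.
  apply: le_trans (box_freq_cover N (Q := fun (i : 'I_m.+1) A => (d < i)%N && P i A) _) _.
    by move=> A /existsP.
  apply: (@le_trans _ _ (\sum_(i < m.+1 | (d < i)%N) (k.+1 * 2 ^ n.+1)%:R * (q%:R ^+ i)^-1)).
    rewrite [X in _ <= X]big_mkcond; apply: ler_sum => i _; case: ifP => di /=.
      apply: degree_freq => //; apply: leq_trans mN.
      by rewrite leq_exp2l ?card_field_gt1 // -ltnS.
    by rewrite box_freq_pred0.
  by rewrite -mulr_sumr ler_wpM2l // geometric_tail.
have tau_inj : injective (fun i : 'I_N.+1 => enum_poly e i).
  by move=> i j /(enum_poly_inj e_bij e0)/val_inj.
have size_tau (i : 'I_N.+1) : (size (enum_poly e i) <= m.+1)%N.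
  by apply: size_enum_poly => //; rewrite (leq_ltn_trans _ Nm) // -ltnS.
have := card_large_dependent tau_inj size_tau (ltn0Sn m) kn.
rewrite card_ord => H; rewrite /box_freq ler_pdivrMr; last first.
  by rewrite ltr0n card_mx card_ord expn_gt0.
by rewrite mulrAC ler_pdivlMr ?ltr0n // -!natrM ler_nat.
Qed.

End Density.

(** * Density of unimodular matrices and the zeta function *)

Section UnimodularDensity.
Variables (R : realType) (F : finFieldType) (e : 'I_#|F| -> F).
Hypothesis e_bij : bijective e.
Hypothesis e0 : forall i : 'I_#|F|, val i = 0%N -> e i = 0.
Let q := #|F|.

Lemma unimodular_full_rank k n (hkn : (k <= n)%N) S (A : 'M[{poly F}]_(k, n)) :
  unimodular hkn A -> full_rank_mod S A.
Proof. by move=> /unimodularP H; apply/asboolP => f _; apply: H (valP f). Qed.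

Lemma unimodular_or_bad k n (hkn : (k <= n)%N) d (A : 'M[{poly F}]_(k, n)) :
  full_rank_mod (irr_le F d) A -> unimodular hkn A \/ has_bad_factor d A.
Proof.
move=> /asboolP frA; have [uA|uA] := pselect (unimodular hkn A); [by left|right].
apply: contrapT => noA; apply: uA; apply/unimodularP => f fi fd.
have [df|df] := ltnP d.+1 (size f).
  by apply: noA; apply/asboolP; exists f.
apply: (frA (exist _ f fi)) fd; rewrite irr_leP.
by rewrite -ltnS -size_monic_irr.
Qed.

(** Used with [x] the claimed density, [y] the product of local densities up to degree [d], and [z]
    and [w] the frequencies of full rank up to degree [d] and of unimodularity. *)
Lemma ler_dist_sandwich (x y z w c : R) : `|x - y| <= c / 4 -> `|y - z| <= c / 4 ->
  w <= z -> z <= w + (c / 4 + c / 4) -> `|x - w| <= c.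
Proof.
rewrite !ler_norml => /andP[a1 a2] /andP[a3 a4] a5 a6.
by apply/andP; split; lra.
Qed.

Lemma unimodular_density k n (hkn : (k <= n)%N) : (0 < k)%N ->
  has_natural_density e [set A : 'M[{poly F}]_(k, n) | unimodular hkn A]
    (\prod_(n - k <= i < n) (1 - (q%:R ^+ i)^-1) : R).
Proof.
case: k n hkn => // k [//|n] hkn _.
rewrite /has_natural_density; under eq_fun do rewrite (box_freqE R e_bij e0).
set l := \prod_(_ <= i < _) _.
pose U : pred 'M[{poly F}]_(k.+1, n.+1) := fun A => `[< unimodular hkn A >].
apply/cvgrPdist_le => eps eps0.
have eps3 : 0 < eps / 4 by rewrite divr_gt0.
have q1 : 1 < q%:R :> R by rewrite ltr1n card_field_gt1.
have main d := box_freq_full_rank_cvg (R := R) e_bij e0 (fset_uniq (irr_le F d)) hkn.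
have /cvgrPdist_le/(_ _ eps3) mainl := @prod_local_density_cvg R F _ _ hkn.
have U_le d N : box_freq R e N U <= box_freq R e N (@full_rank_mod F (irr_le F d) k.+1 n.+1).
  by apply: box_freq_mono => A /asboolP; exact: unimodular_full_rank.
(* In the square case the factor at [i = 0] makes the limit vanish, so the upper bound by full rank
   suffices. *)
have [kn|nk] := ltnP k n; last first.
  have l0 : l = 0.
    rewrite /l (_ : n.+1 - k.+1 = 0)%N; last by apply/eqP; rewrite subn_eq0 ltnS.
    by rewrite big_nat_recl // expr0 invr1 subrr mul0r.
  have [d dl] := filter_ex mainl.
  have /cvgrPdist_le/(_ _ eps3) := main d; apply: filterS => N HN.
  rewrite l0 sub0r normrN ger0_norm ?box_freq_ge0 //.
  rewrite -/l l0 sub0r normrN in dl.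
  have := U_le d N; move: dl HN; rewrite !ler_norml => /andP[_ h1] /andP[h2 _] h3.
  apply: le_trans h3 _; lra.
pose C : R := (k.+1 * 2 ^ n.+1)%:R.
have C0 : 0 < C by rewrite ltr0n muln_gt0 expn_gt0.
have /cvgrPdist_le/(_ _ (divr_gt0 eps3 C0)) tail1 : GRing.exp (q%:R^-1 : R) @ \oo --> (0 : R).
  by apply: cvg_expr; rewrite ger0_norm ?invr_ge0 // invf_lt1 // (lt_trans ltr01).
(* The cutoff [d] is fixed first, making both the truncation error of the product and the geometric
   tail at most [eps / 4]; only then does [N] grow. *)
have [d [dl dC]] := filter_ex (filterI mainl tail1).
pose C' : R := (k.+1 * k.+2)%:R.
have C'0 : 0 < C' by rewrite ltr0n.
have /cvgrPdist_le/(_ _ (divr_gt0 eps3 C'0)) tail2 := @cvg_harmonic R.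
have /cvgrPdist_le/(_ _ eps3) maind := main d.
have pos : \forall N \near \oo, (0 < N)%N by exists 1%N.
near=> N.
have h1 : `|harmonic N : R| <= eps / 4 / C'.
  by rewrite -normrN -sub0r; near: N.
have h2 : `|\prod_(f <- irr_le F d) local_density R k.+1 n.+1 f -
    box_freq R e N (@full_rank_mod F (irr_le F d) k.+1 n.+1)| <= eps / 4 by near: N.
have N0 : (0 < N)%N by near: N.
have bad := bad_factor_freq R e_bij e0 d kn N0.
have split_freq : box_freq R e N (@full_rank_mod F (irr_le F d) k.+1 n.+1) <=
    box_freq R e N U + box_freq R e N (@has_bad_factor F k.+1 n.+1 d).
  apply: le_trans (box_freq_cover R e N (Q := fun b : bool =>
    if b then U else @has_bad_factor F k.+1 n.+1 d) _) _.
    move=> A /(unimodular_or_bad hkn)[uA|bA]; last by exists false.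
    by exists true; apply/asboolP.
  by rewrite big_bool.
have bad1 : C * (q%:R ^+ d)^-1 <= eps / 4.
  rewrite mulrC -ler_pdivlMr //; move: dC; rewrite sub0r normrN ger0_norm ?exprn_ge0 ?invr_ge0 //.
  by rewrite exprVn.
have bad2 : C' / N.+1%:R <= eps / 4.
  rewrite mulrC -ler_pdivlMr //; move: h1; rewrite /harmonic /= ger0_norm // invr_ge0 //.
have fr_le : box_freq R e N (@full_rank_mod F (irr_le F d) k.+1 n.+1) <=
    box_freq R e N U + (eps / 4 + eps / 4).
  exact: le_trans split_freq (lerD (lexx _) (le_trans bad (lerD bad1 bad2))).
exact: ler_dist_sandwich dl h2 (U_le d N) fr_le.
Unshelve. all: by end_near.
Qed.

End UnimodularDensity.

(** * Values of the zeta function and the product over degrees *)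

Section Zeta.
Variables (R : realType) (F : finFieldType).
Let q := #|F|.

Let q_gt0 : 0 < q%:R :> R. Proof. by rewrite ltr0n card_field_gt0. Qed.

Let t_ge0 j : 0 <= (q%:R ^+ j)^-1 :> R.
Proof. by rewrite invr_ge0 exprn_ge0. Qed.

Let qt j : (0 < j)%N -> q%:R * (q%:R ^+ j)^-1 = (q%:R ^+ (j - 1))^-1 :> R.
Proof.
case: j => // j _; rewrite subn1 /= exprS invfM mulrA mulfV ?mul1r //.
by rewrite gt_eqF.
Qed.

Let qt_le1 j : (0 < j)%N -> q%:R * (q%:R ^+ j)^-1 <= 1 :> R.
Proof.
by move=> j0; rewrite qt // invf_le1 ?exprn_gt0 // exprn_ege1 // ler1n card_field_gt0.
Qed.

Lemma euler_prod_exp (S : seq (monic_irr F)) j :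
  \prod_(f <- S) (1 - (q%:R ^+ (j * deg f))^-1) = euler_prod S (q%:R ^+ j)^-1 :> R.
Proof. by apply: eq_bigr => f _; rewrite exprM exprVn. Qed.

Let zeta_limit_neq0 j : (1 < j)%N -> 1 - (q%:R ^+ (j - 1))^-1 != 0 :> R.
Proof.
move=> j1; rewrite subr_eq0 eq_sym lt_eqF // invf_lt1 ?exprn_gt0 //.
by rewrite exprn_egt1 ?ltr1n ?card_field_gt1 // -lt0n subn_gt0.
Qed.

Lemma zetaq_cvg_fset j : (1 < j)%N ->
  (\prod_(f <- (S : {fset monic_irr F})) (1 - (q%:R ^+ (j * deg f))^-1)^-1 : R)
    @[S --> totally] --> ((1 - (q%:R ^+ (j - 1))^-1)^-1 : R).
Proof.
move=> j1; under eq_fun do rewrite prodfV euler_prod_exp.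
apply: cvgV; first exact: zeta_limit_neq0.
by rewrite -qt 1?ltnW //; apply: euler_prod_cvg => //; apply: qt_le1; rewrite ltnW.
Qed.

Lemma zetaqE j : (1 < j)%N -> zetaq R F j = (1 - (q%:R ^+ (j - 1))^-1)^-1.
Proof. by move=> j1; apply: cvg_lim => //; exact: zetaq_cvg_fset. Qed.

Lemma zetaq_invE j : (0 < j)%N -> zetaq_inv R F j = 1 - (q%:R ^+ (j - 1))^-1.
Proof.
(* At [j = 1] the conventional value 0 agrees with the formula, because [q ^ 0 = 1]. *)
rewrite /zetaq_inv; case: eqVneq => [->|j1 j0]; first by rewrite expr0 invr1 subrr.
by rewrite zetaqE ?invrK // ltn_neqAle eq_sym j1.
Qed.

(** The case [j = 1] is the boundary [q t = 1], which [euler_prod_irr_le_cvg] includes. *)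
Lemma phi_prod_cvg j : (0 < j)%N ->
  (\prod_(1 <= m < N.+1) (1 - (q%:R ^+ (j * m))^-1) ^+ phi F m : R) @[N --> \oo]
    --> (1 - (q%:R ^+ (j - 1))^-1 : R).
Proof.
move=> j0.
under eq_fun do rewrite -(prod_irr_le F (fun m => 1 - (q%:R ^+ (j * m))^-1)) euler_prod_exp.
by rewrite -qt //; apply: euler_prod_irr_le_cvg => //; exact: qt_le1.
Qed.

Lemma phi_prodV_cvg j : (1 < j)%N ->
  (\prod_(1 <= m < N.+1) (1 - (q%:R ^+ (j * m))^-1)^-1 ^+ phi F m : R) @[N --> \oo]
    --> ((1 - (q%:R ^+ (j - 1))^-1)^-1 : R).
Proof.
move=> j1.
under eq_fun => N do under eq_bigr do rewrite exprVn.
under eq_fun do rewrite prodfV.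
by apply: cvgV; [exact: zeta_limit_neq0 | apply: phi_prod_cvg; rewrite ltnW].
Qed.

End Zeta.

Theorem mainTheorem2 (R : realType) (F : finFieldType) :
  [/\ fps_is_prod (fun f : monic_irr F => (1 - fpsT ^+ deg f)^-1)
        (FPS (fun l => (#|F| ^ l)%:R : int))
      /\ FPS (fun l => (#|F| ^ l)%:R : int) = (1 - #|F|%:R * fpsT)^-1,
      (forall j : nat, (1 < j)%N ->
         (\prod_(f <- (S : {fset monic_irr F}))
            (1 - (#|F|%:R ^+ (j * deg f))^-1)^-1 : R) @[S --> totally]
           --> zetaq R F j
         /\ (\prod_(1 <= m < N.+1)
              (1 - (#|F|%:R ^+ (j * m))^-1)^-1 ^+ phi F m : R) @[N --> \oo]
           --> zetaq R F j)
      /\ (forall j : nat, (0 < j)%N ->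
            zetaq_inv R F j = 1 - (#|F|%:R ^+ (j - 1))^-1),
      forall (e : 'I_#|F| -> F), bijective e ->
        (forall i : 'I_#|F|, val i = 0%N -> e i = 0) ->
        forall (k n : nat) (hkn : (k <= n)%N), (1 <= k)%N ->
          has_natural_density e [set A : 'M[{poly F}]_(k, n) | unimodular hkn A]
            (\prod_(n - k <= i < n) (1 - (#|F|%:R ^+ i)^-1) : R)
      & forall j : nat, (0 < j)%N ->
        (\prod_(1 <= m < N.+1)
            (1 - (#|F|%:R ^+ (j * m))^-1) ^+ phi F m : R) @[N --> \oo]
          --> (1 - (#|F|%:R ^+ (j - 1))^-1 : R)].

Proof.
split.
- by split; [exact: euler_fps | exact: geometric_fps].
- split=> j j1; last exact: zetaq_invE.
  by rewrite zetaqE //; split; [exact: zetaq_cvg_fset | exact: phi_prodV_cvg].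
- by move=> e e_bij e0 k n hkn k0; exact: unimodular_density.
- by move=> j j0; exact: phi_prod_cvg.
Qed.
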